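(* Let $n$ be a positive integer, let $X_1,X_2,\dots,X_n$ be pseudocompact Tychonoff spaces, let $Y$ be a Tychonoff space, and let $\Phi:\prod_{i=1}^n X_i\to Y$ be a separately continuous map. The following conditions are equivalent: (1) the map $\Phi$ extends to a separately continuous map $\widehat{\Phi}:\prod_{i=1}^n\beta X_i\to\mu Y$; (2) the map $\Phi$ is $2$-$\beta$-extendable; (3) the map $\Phi$ is $2$-quasicontinuous.
   Context: A Tychonoff space is pseudocompact if every continuous real-valued function on it is bounded; $\beta X$ is the Stone–Čech compactification of $X$, with $X\subset\beta X$. A space is Dieudonné complete if it admits a compatible complete uniformity. The Dieudonné completion $\mu Y$ of $Y$ is the smallest Dieudonné complete subspace of $\beta Y$ containing $Y$. A map $f: Z\to Y$ between spaces is quasi-continuous if for every $z\in Z$, every neighborhood $O$ of $f(z)$ and every neighborhood $W$ of $z$ there is a non-empty open $U\subset W$ with $f(U)\subset O$. A map on a product $\prod_{\alpha\in A}X_\alpha$ is separately continuous if it is continuous in each variable when all other variables are fixed. Let $\{X_\alpha:\alpha\in A\}$ be a family of spaces, $Y$ a space, $X=\prod_{\alpha\in A}X_\alpha$ and $\Phi: X\to Y$ a map. For $B\subset A$ and $\bar x=(x_\alpha)_{\alpha\in A\setminus B}\in\prod_{\alpha\in A\setminus B}X_\alpha$ define $$r(\Phi,X,\bar x):\prod_{\alpha\in B}X_\alpha\to Y,\quad (x_\alpha)_{\alpha\in B}\mapsto\Phi((x_\alpha)_{\alpha\in A}).$$ For a positive integer $k$: $\Phi$ is $k$-$\beta$-extendable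 if for each $B\subset A$ with $|B|\le k$ and each $\bar x\in\prod_{\alpha\in A\setminus B}X_\alpha$ the map $g=r(\Phi,X,\bar x)$ extends to a separately continuous map $\hat g:\prod_{\alpha\in B}\beta X_\alpha\to\beta Y$. $\Phi$ is $k$-quasicontinuous if for each $B\subset A$ with $|B|\le k$ and each $\bar x\in\prod_{\alpha\in A\setminus B}X_\alpha$ the map $r(\Phi,X,\bar x)$ is quasi-continuous. In the claim these notions are applied with $A=\{1,\dots,n\}$, $k=2$. *)

(* Defs.v *)
From HB Require Import structures.
From mathcomp Require Import all_boot all_order all_algebra.
From mathcomp Require Import all_classical all_reals all_analysis.

Set Implicit Arguments.
Unset Strict Implicit.
Unset Printing Implicit Defensive.

Import Order.TTheory GRing.Theory Num.Theory.
Import numFieldNormedType.Exports.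
Local Open Scope classical_set_scope.
Local Open Scope ring_scope.

Definition tychonoff_space (X : topologicalType) :=
  completely_regular_space X /\ hausdorff_space X.

Definition pseudocompact (R : realType) (X : topologicalType) :=
  forall f : X -> R, continuous f -> bounded_fun f.

Definition unit_functions (R : realType) (X : topologicalType) : set (X -> R) :=
  [set f : X -> R | continuous f /\ forall x, 0 <= f x <= 1].
Arguments unit_functions R X : clear implicits.

Definition unit_product (R : realType) (X : topologicalType) : topologicalType :=
  prod_topology (fun _ : set_type (unit_functions R X) => R).

Definition unit_eval (R : realType) (X : topologicalType) (x : X) :
  unit_product R X := fun f => set_val f x.
Arguments unit_eval R {X} x.

(* The closure of the image of X in the product of copies of R indexed by the
   continuous functions X -> [0, 1]; that closure lies in the cube, as the
   cube is closed in the product. *)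
Definition stone_cech (R : realType) (X : topologicalType) : topologicalType :=
  set_type (closure (range (unit_eval R (X:=X)))).

Lemma unit_eval_closure (R : realType) (X : topologicalType) (x : X) :
  unit_eval R x \in closure (range (unit_eval R (X:=X))).
Proof. by apply/mem_set/subset_closure; exists x. Qed.

(* The inclusion of X in its Stone-Cech compactification. *)
Definition to_stone_cech (R : realType) (X : topologicalType) (x : X) :
  stone_cech R X := exist _ (unit_eval R x) (unit_eval_closure R x).
Arguments to_stone_cech R {X} x.

Lemma compact_set_type (T : topologicalType) (A : set T) :
  compact A -> compact [set: set_type A].
Proof.
move=> cA F FF _.
have GF : ProperFilter (set_val @ F) by exact: fmap_proper_filter.
have GA : (set_val @ F) A.
  by apply: (@filterS _ F _ setT) filterT; case=> x xA _; exact: set_mem.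
have [p [Ap clp]] := cA _ GF GA.
exists (exist _ p (mem_set Ap)); split => // B V FB [_ [[W oW <-] Wp WV]].
have : (set_val @` B) `&` W !=set0.
  apply: clp; last exact: open_nbhs_nbhs.
  by apply: (@filterS _ F _ B) => // x Bx; exists x.
by move=> [_ [[x Bx <-] Wx]]; exists x; split => //; exact: WV.
Qed.

Lemma hausdorff_set_type (T : topologicalType) (A : set T) :
  hausdorff_space T -> hausdorff_space (set_type A).
Proof.
move=> hT x y cxy; apply/val_inj/hT => U V Ux Vy.
have [z [Uz Vz]] := cxy _ _
  ((@initial_continuous (set_type A) T set_val x) _ Ux)
  ((@initial_continuous (set_type A) T set_val y) _ Vy).
by exists (set_val z).
Qed.

Lemma hausdorff_stone_cech (R : realType) (X : topologicalType) :
  hausdorff_space (stone_cech R X).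
Proof.
by apply/hausdorff_set_type/hausdorff_product => _; exact: Rhausdorff.
Qed.

Lemma compact_stone_cech (R : realType) (X : topologicalType) :
  compact [set: stone_cech R X].
Proof.
apply: compact_set_type.
pose K : set (unit_product R X) :=
  [set g | forall f, `[0 : R, 1]%classic (g f)].
have cK : compact K.
  exact: (@tychonoff _
    (fun _ : set_type (unit_functions R X) => R : topologicalType)
    (fun=> `[0, 1]%classic) (fun=> @segment_compact R 0 1)).
have hC : hausdorff_space (unit_product R X).
  by apply: hausdorff_product => _; exact: Rhausdorff.
apply: (subclosed_compact _ cK); first exact: closed_closure.
rewrite ((closure_id K).1 (compact_closed hC cK)).
apply: closureS => _ [x _ <-] f.
by rewrite /= in_itv; case: (set_mem (valP f)) => _; exact.
Qed.

(* Uniform.axioms_ T carries a topology of its own besides the entourages: the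
   first conjunct says that it is the given topology of T. *)
Definition dieudonne_complete (T : topologicalType) :=
  exists uT : Uniform.axioms_ T, let UT := Uniform.Pack uT in
    (forall x : T, @nbhs UT UT x = @nbhs T T x) /\
    (forall F : set_system UT, ProperFilter F -> cauchy F ->
      exists x : UT, F --> x).

Lemma compact_dieudonne_complete (U : uniformType) :
  compact [set: U] -> dieudonne_complete U.
Proof.
move=> cU; exists (Uniform.class U); split=> // F FF Fc.
have [x [_ clx]] := cU F FF filterT.
exists x => V /nbhsP [E entE EV].
have [[P Q] /= [FP FQ] PQE] := Fc _ (entourage_split_ent entE).
have [z [Pz Ez]] := clx _ _ FP (nbhs_entourage x (entourage_split_ent entE)).
apply: filterS FQ => y Qy; apply/EV/mem_set.
apply: (entourage_split z) => //; first exact/xsectionP.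
exact: (PQE (z, y)).
Qed.

Lemma dieudonne_complete_stone_cech (R : realType) (X : topologicalType) :
  dieudonne_complete (set_type [set: stone_cech R X]).
Proof.
set T := (X in dieudonne_complete X).
have cT : compact [set: T].
  by apply: compact_set_type; exact: compact_stone_cech.
have hT : hausdorff_space T.
  by apply: hausdorff_set_type; exact: hausdorff_stone_cech.
have crT : completely_regular_space T.
  apply: (@normal_completely_regular R); first exact: compact_normal.
  exact: hausdorff_accessible.
exact: (@compact_dieudonne_complete
  (@completely_regular_uniformity.type R T crT)).
Qed.

Lemma dieudonne_complete_bigcap (T : topologicalType) (C : set (set T)) :
  hausdorff_space T -> C !=set0 ->
  (forall M, C M -> dieudonne_complete (set_type M)) ->
  dieudonne_complete (set_type (\bigcap_(M in C) M)).
Proof.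
move=> hT [M0 CM0] dC; set D := \bigcap_(M in C) M.
have sub (j : C) (x : D) : val x \in val j.
  by apply/mem_set; exact: (set_mem (valP x)) (set_mem (valP j)).
pose incl (j : C) (x : D) : set_type (val j) := exist _ (val x) (sub j x).
have incl_cont j : continuous (incl j).
  move=> x A [_ [[V oV <-] Vx VA]]; exists (incl j @^-1` (set_val @^-1` V)).
  by split => //=; [exists V|move=> z /= Vz; exact: VA].
pose uT (j : C) := projT1 (cid (dC _ (set_mem (valP j)))).
pose UT j := Uniform.Pack (uT j).
have uTP (j : C) :
    (forall x, @nbhs (UT j) (UT j) x = nbhs (x : set_type (val j))) /\
    (forall F : set_system (UT j), ProperFilter F -> cauchy F ->
      exists x : UT j, F --> x).
  exact: projT2 (cid (dC _ (set_mem (valP j)))).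
pose S : uniformType := sup_topology
  (fun j : C => Uniform.class (initial_topology (incl j : D -> UT j))).
have cvgS (F : set_system D) (x : D) : Filter F ->
    (F --> (x : S)) <-> forall j, (incl j @ F) --> (incl j x : UT j).
  move=> FF; split.
    move=> /cvg_sup Fx j A Ax; apply: (Fx j).
    exact: (@initial_continuous D (UT j) (incl j) x A Ax).
  move=> Fx; apply/cvg_sup => j A [_ [[V oV <-] Vx VA]].
  apply: filterS VA _; apply: (Fx j); exact: open_nbhs_nbhs.
have ent_incl j (E : set (UT j * UT j)) : entourage E ->
    @entourage S [set p | E (incl j p.1, incl j p.2)].
  move=> entE; pose E' : set (D * D) := [set p | E (incl j p.1, incl j p.2)].
  have entE' : @entourage (initial_topology (incl j : D -> UT j)) E'.
    by exists E.
  pose TS (k : C) := Uniform.Pack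
    (Uniform.class (initial_topology (incl k : D -> UT k))).
  have ejE : `[< @entourage (TS (j, E').1) (j, E').2 >] by apply/asboolP.
  exists E' => //.
  exact: (@finI_from1 {p : {classic C} * set (D * D) |
    `[< @entourage (TS p.1) p.2 >]} _ setT (fun p => (projT1 p).2)
    (exist _ (j, E') ejE)).
exists (Uniform.class S); split.
  move=> x; rewrite eqEsubset; split.
    apply/(cvgS (nbhs x) x _) => j A.
    rewrite (uTP j).1 => Ax.
    exact: incl_cont Ax.
  move=> A [_ [[V oV <-] Vx VA]].
  pose j0 : C := exist _ M0 (mem_set CM0).
  have := (cvgS (@nbhs S S x) x (nbhs_filter (x : S))).1 (fun B h => h) j0.
  move=> /(_ (set_val @^-1` V)); rewrite (uTP j0).1 => h.
  apply: (@filterS _ (@nbhs S S x) _ _ _ VA); apply: h.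
  by apply: open_nbhs_nbhs; split => //; exists V.
move=> F FF Fc.
have cvgj (j : C) : exists x : UT j, (incl j @ F) --> x.
  apply: (uTP j).2 => E /ent_incl /Fc [[P Q] /= [FP FQ] PQE].
  exists (incl j @` P, incl j @` Q).
    split=> /=.
      by apply: filterS FP => z Pz; exists z.
    by apply: filterS FQ => z Qz; exists z.
  by move=> [_ _] /= [[a Pa <-] [b Qb <-]]; exact: (PQE (a, b)).
have cvgv (j : C) (y : UT j) : (incl j @ F) --> y ->
    (fun z : D => val z : T) @ F --> (val (y : set_type (val j)) : T).
  move=> Fy A Ay; apply: (Fy (set_val @^-1` A)); rewrite (uTP j).1.
  exact: (@initial_continuous (set_type (val j)) T set_val y A Ay).
pose j0 : C := exist _ M0 (mem_set CM0).
have [y0 Fy0] := cvgj j0.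
have yE (j : C) (y : UT j) : (incl j @ F) --> y ->
    val (y : set_type (val j)) = val (y0 : set_type M0).
  move=> Fy; apply: (cvg_unique hT (cvgv _ _ Fy) (cvgv _ _ Fy0)).
have Dy0 : val (y0 : set_type M0) \in D.
  apply/mem_set => M CM; pose j : C := exist _ M (mem_set CM).
  have [y /yE <-] := cvgj j.
  exact: (set_mem (valP (y : set_type M))).
exists (exist _ (val (y0 : set_type M0)) Dy0 : D).
apply/cvgS => j; have [y Fy] := cvgj j.
suff -> : incl j (exist _ (val (y0 : set_type M0)) Dy0) = y by [].
by apply: val_inj; rewrite /= (yE _ _ Fy).
Qed.

(* The smallest Dieudonne complete subspace of the Stone-Cech compactification
   that contains Y, see dieudonne_completion_smallest. *)
Definition dieudonne_completion (R : realType) (Y : topologicalType) :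
    set (stone_cech R Y) :=
  \bigcap_(M in [set M : set (stone_cech R Y) |
      range (to_stone_cech R (X:=Y)) `<=` M /\
      dieudonne_complete (set_type M)]) M.
Arguments dieudonne_completion R Y : clear implicits.

Lemma dieudonne_completion_smallest (R : realType) (Y : topologicalType) :
  [/\ range (to_stone_cech R (X:=Y)) `<=` dieudonne_completion R Y,
      dieudonne_complete (set_type (dieudonne_completion R Y)) &
      forall M : set (stone_cech R Y),
        range (to_stone_cech R (X:=Y)) `<=` M ->
        dieudonne_complete (set_type M) -> dieudonne_completion R Y `<=` M].
Proof.
split.
- by move=> y Yy M [YM _]; exact: YM.
- apply: dieudonne_complete_bigcap; first exact: hausdorff_stone_cech.
    by exists setT; split=> //; exact: dieudonne_complete_stone_cech.
  by move=> M [].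
- by move=> M YM dM y; apply; split.
Qed.

Definition quasi_continuous (Z Y : topologicalType) (f : Z -> Y) :=
  forall (z : Z) (O : set Y) (W : set Z), nbhs (f z) O -> nbhs z W ->
    exists U : set Z, [/\ open U, U !=set0, U `<=` W & f @` U `<=` O].

Definition separately_continuous (I : eqType) (X : I -> topologicalType)
    (Y : topologicalType) (f : (forall i, X i) -> Y) :=
  forall (x : forall i, X i) (i : I),
    continuous (fun t : X i => f (dfwith x i t)).

Section restrictions.
Variables (I : finType) (X : I -> topologicalType) (Y : topologicalType).
Variables (Phi : (forall i, X i) -> Y) (B : {set I}).

Definition glue (xbar : forall i : {i | i \notin B}, X (sval i))
    (x : forall i : {i | i \in B}, X (sval i)) : forall i, X i :=
  fun i => match boolP (i \in B) with
           | AltTrue iB => x (exist _ i iB)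
           | AltFalse iB => xbar (exist _ i iB)
           end.

Definition restriction (xbar : forall i : {i | i \notin B}, X (sval i)) :
    prod_topology (fun i : {i | i \in B} => X (sval i)) -> Y :=
  fun x => Phi (glue xbar x).

End restrictions.

Definition beta_extendable (R : realType) (k : nat) (I : finType)
    (X : I -> topologicalType) (Y : topologicalType)
    (Phi : (forall i, X i) -> Y) :=
  forall B : {set I}, (#|B| <= k)%N ->
  forall xbar : forall i : {i | i \notin B}, X (sval i),
  exists ghat : (forall i : {i | i \in B}, stone_cech R (X (sval i))) ->
      stone_cech R Y,
    separately_continuous ghat /\
    forall x : forall i : {i | i \in B}, X (sval i),
      ghat (fun i => to_stone_cech R (x i)) =
      to_stone_cech R (restriction Phi xbar x).

Definition quasicontinuous (k : nat) (I : finType)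
    (X : I -> topologicalType) (Y : topologicalType)
    (Phi : (forall i, X i) -> Y) :=
  forall B : {set I}, (#|B| <= k)%N ->
  forall xbar : forall i : {i | i \notin B}, X (sval i),
    quasi_continuous (restriction Phi xbar).

Definition extends_to_dieudonne_completion (R : realType) (I : finType)
    (X : I -> topologicalType) (Y : topologicalType)
    (Phi : (forall i, X i) -> Y) :=
  exists Phihat : (forall i, stone_cech R (X i)) ->
      set_type (dieudonne_completion R Y),
    separately_continuous Phihat /\
    forall x : forall i, X i,
      set_val (Phihat (fun i => to_stone_cech R (x i))) =
      to_stone_cech R (Phi x).

(* Main.v *)
Require Import Defs.
From mathcomp Require Import all_boot all_order all_algebra.
From mathcomp Require Import all_classical all_reals all_analysis.
From mathcomp Require Import lra.

(** The bridge between the conditions is Grothendieck's double limit condition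
for real functions of two variables: there are no sequences [s m], [t n] for
which [f (s m) (t n)] is uniformly closer to some value for [m < n] than for
[n < m].  It holds for restrictions of separately continuous functions on a
product of two compact spaces, and it implies quasi-continuity; composing with
functions [Y -> [0, 1]], this gives (2) => (3).

For (3) => (1), separately continuous quasi-continuous functions on a product
of two pseudocompact spaces satisfy the double limit condition.  As the
condition only involves countably many values, and every point of beta X
agrees with a point of X on any given countable family of continuous functions
when X is pseudocompact, it survives when the factors are replaced by their
compactifications one coordinate at a time; it is also what makes the function
extended in one coordinate extendable in the next one.  Running this over all
functions [Y -> [0, 1]] yields an extension with values in beta Y.  Its values
lie in mu Y, again coordinate by coordinate: if p is in beta X, the image of an
ultrafilter on X converging to p is Cauchy in mu Y, since otherwise there would
be an infinite uniformly separated, hence locally finite, sequence of open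
sets in the pseudocompact space X. *)

Set Implicit Arguments.
Unset Strict Implicit.
Unset Printing Implicit Defensive.

Import Order.TTheory GRing.Theory Num.Theory.
Import numFieldNormedType.Exports.
Local Open Scope classical_set_scope.
Local Open Scope ring_scope.

(** * Continuous real-valued functions *)

Section real_valued_functions.
Variables (R : realType) (T : topologicalType).

Lemma sum_ord_continuous (f : nat -> T -> R) (n : nat) :
  (forall i, continuous (f i)) -> continuous (fun x => \sum_(i < n) f i x).
Proof.
move=> cf; elim: n => [|n IH].
  under eq_fun do rewrite big_ord0; exact: cst_continuous.
under eq_fun do rewrite big_ord_recr /=.
by move=> x; exact: cvgD (IH x) (cf n x).
Qed.

Lemma distr_continuous (f : T -> R) (v : R) :
  continuous f -> continuous (fun x => `|f x - v|).
Proof. by move=> cf x; exact: cvg_norm (cvgB (cf x) (cvg_cst _)). Qed.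

Lemma open_ltf (f : T -> R) (a : R) : continuous f -> open [set x | f x < a].
Proof. by move=> cf; exact: open_comp (fun x _ => cf x) (open_lt (y:=a)). Qed.

Lemma open_gtf (f : T -> R) (a : R) : continuous f -> open [set x | a < f x].
Proof. by move=> cf; exact: open_comp (fun x _ => cf x) (open_gt (y:=a)). Qed.

Lemma closed_lef (f : T -> R) (a : R) :
  continuous f -> closed [set x | f x <= a].
Proof. by move=> cf; exact: closed_comp (fun x _ => cf x) (closed_le (y:=a)). Qed.

Lemma closed_gef (f : T -> R) (a : R) :
  continuous f -> closed [set x | a <= f x].
Proof. by move=> cf; exact: closed_comp (fun x _ => cf x) (closed_ge (y:=a)). Qed.

End real_valued_functions.

(** * Cluster points and pseudocompactness *)

Definition cluster_point (T : topologicalType) (A : nat -> set T) (x : T) :=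
  forall W : set T, nbhs x W ->
  forall n, exists2 m, (n <= m)%N & A m `&` W !=set0.

(** The form in which pseudocompactness is used below: no sequence of non-empty open sets is locally
    finite. *)
Definition feebly_compact (T : topologicalType) :=
  forall A : nat -> set T, (forall n, open (A n)) -> (forall n, A n !=set0) ->
  exists x, cluster_point A x.

(** This replaces the passage to the limit in a weak inequality, [C] being a level set of a
    continuous function. *)
Lemma cluster_point_closed (T : topologicalType) (A : nat -> set T) (x : T)
    (C : set T) (n : nat) : closed C -> cluster_point A x ->
  (forall m, (n <= m)%N -> A m `<=` C) -> C x.
Proof.
move=> cC Ax AC; apply: cC => W /Ax /(_ n)[m nm [y [Ay Wy]]].
by exists y; split => //; exact: AC Ay.
Qed.

Lemma compact_cluster_point (T : topologicalType) (s : nat -> T) :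
  compact [set: T] -> exists x, cluster_point (fun n => [set s n]) x.
Proof.
move=> /(_ (s @ \oo) _ filterT)[x [_ clx]]; exists x => W xW n.
have sn : (s @ \oo) (s @` [set m | (n <= m)%N]).
  by exists n => // m /= nm; exists m.
by have [_ [[m /= nm <-] Wsm]] := clx _ _ sn xW; exists m => //; exists (s m).
Qed.

Lemma completely_regular_bump (R : realType) (X : topologicalType) (x : X)
    (O : set X) : completely_regular_space X -> nbhs x O ->
  exists f : X -> R, [/\ continuous f, forall y, 0 <= f y <= 1, f x = 1 &
    forall y, ~ O y -> f y = 0].
Proof.
rewrite nbhsE => crX [U [oU Ux] UO].
have /uniform_separatorP : uniform_separator [set x] (~` U).
  by apply: crX => [|/(_ Ux)//]; exact: open_closedC.
move=> /(_ R)[f [cf f01 fx fU]]; exists (fun y => 1 - f y); split.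
- by move=> y; apply: cvgB; [exact: cvg_cst|exact: cf].
- move=> y; have /= : range f (f y) by exists y.
  by move=> /f01; rewrite /= in_itv /= => /andP[? ?]; lra.
- by rewrite (fx (f x)) ?subr0//; exists x.
- by move=> y nOy; rewrite (fU (f y)) ?subrr//; exists y => // /UO.
Qed.

(** A sequence [A] without cluster point is locally finite, so a sum of bumps of height n, vanishing
    outside [A n], is continuous; it is also unbounded. *)
Lemma pseudocompact_feebly_compact (R : realType) (X : topologicalType) :
  completely_regular_space X -> pseudocompact R X -> feebly_compact X.
Proof.
move=> crX pX A oA A0; apply: contrapT => /forallNP nA.
have {nA} /choice[WN WNP] : forall x : X, exists WN : set X * nat,
    nbhs x WN.1 /\ forall m, (WN.2 <= m)%N -> A m `&` WN.1 = set0.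
  move=> x; have /existsNP[W /not_implyP[xW /existsNP[n nW]]] := nA x.
  exists (W, n); split => // m nm; apply: contrapT => /eqP/set0P AW.
  by apply: nW; exists m.
have /choice[u uA] : forall n, exists x, A n x by exact: A0.
have /choice[f fP] : forall n, exists f : X -> R, [/\ continuous f,
    forall y, 0 <= f y <= 1, f (u n) = 1 & forall y, ~ A n y -> f y = 0].
  by move=> n; apply: completely_regular_bump => //; exact: open_nbhs_nbhs.
pose s n x := \sum_(m < n) m%:R * f m x.
have sS n x : s n.+1 x = s n x + n%:R * f n x by rewrite /s big_ord_recr.
have s_cont n : continuous (s n).
  apply: (sum_ord_continuous (f:=fun m x => m%:R * f m x)) => m x.
  by apply: cvgM; [exact: cvg_cst|case: (fP m) => cf _ _ _; exact: cf].
have s_stable x z n : (WN x).1 z -> ((WN x).2 <= n)%N ->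
    s n z = s (WN x).2 z.
  move=> Wz /subnKC <-; elim: (n - _)%N => [|k IH]; first by rewrite addn0.
  rewrite addnS sS IH; case: (fP ((WN x).2 + k)%N) => _ _ _ -> //.
    by rewrite mulr0 addr0.
  move=> Az; have /seteqP[+ _] := (WNP x).2 _ (leq_addr k _).
  by move=> /(_ z); apply.
(* The infinite sum, cut at the index from which the [A m] miss the chosen neighborhood of x; by
   [s_stable] all later truncations agree there. *)
pose g x := s (WN x).2 x.
have gE x z : (WN x).1 z -> g z = s (WN x).2 z.
  move=> Wz; have Wzz : (WN z).1 z by exact: nbhs_singleton (WNP z).1.
  rewrite -(s_stable x z (maxn (WN x).2 (WN z).2)) ?leq_maxl//.
  by rewrite (s_stable z) ?leq_maxr.
have g_cont : continuous g.
  move=> x; rewrite /continuous_at (gE x x); last exact: nbhs_singleton (WNP x).1.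
  apply: cvg_trans (s_cont (WN x).2 x); apply: near_eq_cvg.
  by apply: filterS (WNP x).1 => z Wz; rewrite /= (gE x z Wz).
have [M [_ /(_ (M + 1))]] := pX g g_cont.
rewrite ltrDl ltr01 => /(_ isT) gM.
(* The n-th term alone exceeds the bound at [u n]; the truncation is pushed beyond n so as to
   contain it. *)
pose n := (Num.truncn (M + 1)).+1.
have Mn : M + 1 < n%:R by rewrite /n truncnS_gt.
have := gM (u n) I; apply/negP; rewrite -ltNge (lt_le_trans Mn)//.
apply: le_trans (ler_norm _).
have Wu : (WN (u n)).1 (u n) by exact: nbhs_singleton (WNP (u n)).1.
rewrite /g -(s_stable (u n) _ (maxn (WN (u n)).2 n.+1)) ?leq_maxl//.
have nk : (n < maxn (WN (u n)).2 n.+1)%N by rewrite leq_maxr.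
rewrite /s (bigD1 (Ordinal nk))//=; case: (fP n) => _ _ -> _.
rewrite mulr1 lerDl sumr_ge0// => i _.
by rewrite mulr_ge0//; case: (fP i) => _ /(_ (u n))/andP[].
Qed.

(** * The Stone-Čech compactification *)

Lemma prod_topology_continuous (T : topologicalType) (I : Type)
    (K : I -> topologicalType) (f : T -> prod_topology K) :
  (forall i, continuous (fun x => f x i)) -> continuous f.
Proof.
move=> cf x; apply/cvg_sup => i A [_ [[V oV <-] Vx VA]].
by apply: filterS VA _; apply: (cf i); exact: open_nbhs_nbhs.
Qed.

Lemma to_stone_cech_continuous (R : realType) (X : topologicalType) :
  continuous (to_stone_cech R (X:=X)).
Proof.
have ec : continuous (unit_eval R (X:=X) : X -> unit_product R X).
  by apply: prod_topology_continuous => f; exact: (set_mem (valP f)).1.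
by move=> x A [_ [[V oV <-] Vx VA]]; apply: filterS VA _; apply: ec;
   exact: open_nbhs_nbhs.
Qed.

Lemma to_stone_cech_dense (R : realType) (X : topologicalType)
    (p : stone_cech R X) (W : set (stone_cech R X)) :
  nbhs p W -> exists x : X, W (to_stone_cech R x).
Proof.
move=> [_ [[V oV <-] Vp VW]].
have [_ [[x _ <-] Vx]] := set_mem (valP p) V (open_nbhs_nbhs (conj oV Vp)).
by exists x; exact: VW.
Qed.

(** The continuous extension of f to beta X is the projection to the coordinate f. *)
Definition stone_cech_ext (R : realType) (X : topologicalType)
    (f : unit_functions R X) (p : stone_cech R X) : R := val p f.

Lemma stone_cech_ext_continuous (R : realType) (X : topologicalType)
    (f : unit_functions R X) : continuous (stone_cech_ext f).
Proof.
move=> p; apply: (@cvg_comp _ _ _ set_val (fun g : unit_product R X => g f)).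
  exact: initial_continuous.
exact: (@proj_continuous _
  (fun _ : set_type (unit_functions R X) => R : topologicalType) f (val p)).
Qed.

Lemma stone_cech_closed (R : realType) (X : topologicalType)
    (C : set (stone_cech R X)) (p : stone_cech R X) :
  closed C -> (forall x, C (to_stone_cech R x)) -> C p.
Proof.
move=> cC Cx; apply: cC => W /to_stone_cech_dense[x Wx].
by exists (to_stone_cech R x).
Qed.

Lemma stone_cech_extension (R : realType) (X : topologicalType) (f : X -> R) :
  continuous f -> (forall x, 0 <= f x <= 1) ->
  exists h : stone_cech R X -> R, [/\ continuous h,
    forall x, h (to_stone_cech R x) = f x & forall p, 0 <= h p <= 1].
Proof.
move=> cf f01; pose F : unit_functions R X := exist _ f (mem_set (conj cf f01)).
have cF := stone_cech_ext_continuous (f:=F).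
exists (stone_cech_ext F); split => // p; apply/andP; split.
  apply: (stone_cech_closed (C:=[set p | 0 <= stone_cech_ext F p])).
    exact: closed_gef.
  by move=> x; case/andP: (f01 x).
apply: (stone_cech_closed (C:=[set p | stone_cech_ext F p <= 1])).
  exact: closed_lef.
by move=> x; case/andP: (f01 x).
Qed.

Lemma to_stone_cech_inj (R : realType) (X : topologicalType) :
  tychonoff_space X -> injective (to_stone_cech R (X:=X)).
Proof.
move=> [crX hX] x y /(congr1 val)/= xy; apply: contrapT => nxy.
have cy : closed [set y] by exact: accessible_closed_set1 (hausdorff_accessible hX) _.
have [f [cf f01 fx fy]] := @completely_regular_bump R X x (~` [set y]) crX
  (open_nbhs_nbhs (conj (closed_openC cy) nxy)).
pose F : unit_functions R X := exist _ f (mem_set (conj cf f01)).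
have : f x = f y := congr1 (fun g => g F) xy.
by rewrite fx fy; [move=> /eqP; rewrite oner_eq0|apply].
Qed.

(** The common level set of the [h n] through p is a non-empty G-delta set of beta X, and a feebly
    compact X meets it: a cluster point of the open sets [A n], which are non-empty by density and
    on which more and more [h i] are close to [h i p], lies in it. *)
Lemma stone_cech_countable_approx (R : realType) (X : topologicalType)
    (h : nat -> stone_cech R X -> R) (p : stone_cech R X) :
  feebly_compact X -> (forall n, continuous (h n)) ->
  exists x : X, forall n, h n (to_stone_cech R x) = h n p.
Proof.
move=> fX ch.
pose d n q := \sum_(i < n) `|h i q - h i p|.
have cd n : continuous (d n).
  by apply: (sum_ord_continuous (f:=fun i q => `|h i q - h i p|)) => i;
     exact: distr_continuous.
pose A n := [set x : X | d n (to_stone_cech R x) < n.+1%:R^-1].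
have cdi n : continuous (fun x : X => d n (to_stone_cech R x)).
  by move=> x; apply: continuous_comp; [exact: to_stone_cech_continuous|exact: cd].
have [|n|x Ax] := fX A.
- by move=> n; exact: open_ltf.
- have /to_stone_cech_dense[x dx] : nbhs p [set q | d n q < n.+1%:R^-1].
    apply: open_nbhs_nbhs; split; first exact: open_ltf.
    by rewrite /= /d big1 ?invr_gt0// => i _; rewrite subrr normr0.
  by exists x.
exists x => i; apply/eqP; rewrite -subr_eq0 -normr_le0.
apply/ler_addgt0Pr => e e0; rewrite add0r.
(* From N on, the sum [d m] contains the i-th term and is below e. *)
pose N := maxn i.+1 (Num.truncn e^-1).+1.
have Ne : N.+1%:R^-1 <= e.
  rewrite invf_ple ?posrE// ltW// (lt_trans (truncnS_gt _))// ltr_nat ltnS.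
  by rewrite leq_maxr.
apply: (cluster_point_closed (n:=N) (C:=[set x |
    `|h i (to_stone_cech R x) - h i p| <= e]) _ Ax).
  apply: closed_lef; apply: distr_continuous => z.
  by apply: continuous_comp; [exact: to_stone_cech_continuous|exact: ch].
move=> m Nm z /= Az; apply: le_trans Ne; apply: le_trans (_ : m.+1%:R^-1 <= _).
  apply: le_trans (ltW Az); have im : (i < m)%N.
    by apply: leq_trans Nm; rewrite leq_maxl.
  by rewrite /d (bigD1 (Ordinal im))//= lerDl sumr_ge0.
by rewrite lef_pV2 ?posrE// ler_nat.
Qed.

(** * Double limits and quasi-continuity *)

(** Dependent choice for the recursive constructions below: [G] describes a single stage, [r] its
    relation to the next one, and transitivity carries [r] over to all later stages. *)
Lemma transitive_chain (T : Type) (G : T -> Prop) (r : T -> T -> Prop) :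
  (forall y x z, r x y -> r y z -> r x z) -> (exists z, G z) ->
  (forall z, G z -> exists2 z', G z' & r z z') ->
  exists2 z : nat -> T, forall n, G (z n) &
    forall m n, (m < n)%N -> r (z m) (z n).
Proof.
move=> rtrans [z0 Gz0] step.
have [f fP] : {f : T -> T & forall z, G z -> G (f z) /\ r z (f z)}.
  apply: (@choice T T (fun z z' => G z -> G z' /\ r z z')) => z.
  have [/step[z' Gz' rz]|nGz] := pselect (G z); first by exists z'.
  by exists z.
have GI n : G (iter n f z0) by elim: n => // n IH; exact: (fP _ IH).1.
exists (fun n => iter n f z0) => // m n; apply: (homo_ltn rtrans) => i.
exact: (fP _ (GI i)).2.
Qed.

Definition separately_continuous2 (X Y Z : topologicalType) (f : X -> Y -> Z) :=
  (forall x, continuous (f x)) /\ (forall y, continuous (f^~ y)).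

(** Quasi-continuity on the product in curried form, with open boxes, which form a base, in place of
    open sets. *)
Definition quasi_continuous2 (X Y Z : topologicalType) (f : X -> Y -> Z) :=
  forall (x : X) (y : Y) (O : set Z) (A : set X) (B : set Y),
    nbhs (f x y) O -> nbhs x A -> nbhs y B ->
  exists U V, [/\ open U /\ open V, U !=set0 /\ V !=set0, U `<=` A, V `<=` B &
    forall x' y', U x' -> V y' -> O (f x' y')].

(* Grothendieck's double limit condition, in a form which does not mention
   limits. *)
Definition double_limit_condition (R : realType) (S T : Type)
    (A : set S) (B : set T) (f : S -> T -> R) :=
  ~ exists (s : nat -> S) (t : nat -> T) (v a b : R),
    [/\ forall n, A (s n) /\ B (t n), a < b,
        forall m n, (m < n)%N -> `|f (s m) (t n) - v| <= a &
        forall m n, (n < m)%N -> b <= `|f (s m) (t n) - v|].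

(** If f were at distance at least e from [f x0 y0] somewhere in each box under consideration, such
    points (x, y) could be chosen successively, shrinking [U] around x to where f (-, y) stays far
    and [V] around y0 to where f (x, -) stays closer. Later points lie in earlier boxes, which
    contradicts the double limit condition. *)
Lemma double_limit_quasi_continuous2 (R : realType) (X Y : topologicalType)
    (f : X -> Y -> R) : separately_continuous2 f ->
  double_limit_condition setT setT f -> quasi_continuous2 f.
Proof.
move=> [cfx cfy] dlf x0 y0 O A B /nbhs_ballP[e /= e0 eO] xA yB.
pose g x y := `|f x y - f x0 y0|.
have cgx x : continuous (g x) by exact: distr_continuous.
have cgy y : continuous (g^~ y) by apply: distr_continuous; exact: cfy.
apply: contrapT => nUV; apply: dlf.
(* On [U0] the value at y0 is small, so y0 survives each cut of [V] to where g (x, -) is below e /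
   2. *)
pose U0 := A° `&` [set x | g x y0 < e / 4].
have oU0 : open U0 by apply: openI; [exact: open_interior|exact: open_ltf].
have U0x0 : U0 x0 by split => //=; rewrite /g subrr normr0 divr_gt0.
have step (U : set X) (V : set Y) : open U -> U !=set0 -> U `<=` U0 ->
    open V -> V y0 -> V `<=` B -> exists x y, [/\ U x, V y & e <= g x y].
  move=> oU U_0 UU oV Vy0 VB; apply: contrapT => nxy; apply: nUV.
  exists U, V; split => //; [by split => //; exists y0|..].
    by move=> x /UU[/interior_subset].
  move=> x y Ux Vy; apply: eO; rewrite -ball_normE /= distrC ltNge; apply/negP => exy.
  by apply: nxy; exists x, y.
(* A stage is ((U, V), (x, y)), with [U] and [V] already cut down; [V] contains y0 but not
   necessarily y. *)
pose G (z : (set X * set Y) * (X * Y)) :=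
  [/\ open z.1.1 /\ open z.1.2, z.1.1 z.2.1, z.1.1 `<=` U0,
    z.1.2 y0 /\ z.1.2 `<=` B & (forall y, z.1.2 y -> g z.2.1 y < e / 2) /\
    (forall x, z.1.1 x -> 3 * e / 4 < g x z.2.2)].
pose r (z z' : (set X * set Y) * (X * Y)) :=
  [/\ z'.1.1 `<=` z.1.1, z'.1.2 `<=` z.1.2 & z.1.2 z'.2.2].
have next (U : set X) (V : set Y) : open U -> U !=set0 -> U `<=` U0 ->
    open V -> V y0 -> V `<=` B ->
    exists z, [/\ G z, z.1.1 `<=` U, z.1.2 `<=` V & V z.2.2].
  move=> oU U_0 UU oV Vy0 VB.
  have [x [y [Ux Vy exy]]] := step U V oU U_0 UU oV Vy0 VB.
  have [_ /= xy0] := UU _ Ux.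
  exists ((U `&` [set x | 3 * e / 4 < g x y], V `&` [set y | g x y < e / 2]),
    (x, y)); split => //=; split => /=.
  - by split; apply: openI => //; [exact: open_gtf|exact: open_ltf].
  - by split => //=; lra.
  - by move=> ? [/UU].
  - by split; [split => //=; lra|move=> ? [/VB]].
  - by split => ? [].
have [|||z zG zr] := @transitive_chain _ G r.
- move=> z1 z2 z3 [U12 V12 z12] [U23 V23 z23].
  by split; [exact: subset_trans U12|exact: subset_trans V12|exact: V12].
- have [||||z [Gz _ _ _]] := next U0 B° oU0 _ (@subset_refl _ _).
  + by exists x0.
  + exact: open_interior.
  + exact: yB.
  + exact: interior_subset.
  + by exists z.
- move=> z [[oU oV] Uz UU [Vy0 VB] _].
  have U_0 : z.1.1 !=set0 by exists z.2.1.
  have [z' [Gz' ? ? ?]] := next _ _ oU U_0 UU oV Vy0 VB.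
  by exists z'.
exists (fun n => (z n).2.1), (fun n => (z n).2.2), (f x0 y0), (e / 2),
  (3 * e / 4); split => // [|m n mn|m n nm]; first lra.
- have [_ _ Vy] := zr _ _ mn; have [_ _ _ _ [+ _]] := zG m.
  by move=> /(_ _ Vy)/ltW.
- have [Um _ _] := zr _ _ nm; have [_ _ _ _ [_ +]] := zG n.
  have [_ Umx _ _ _] := zG m.
  by move=> /(_ _ (Um _ Umx))/ltW.
Qed.

(** At cluster points p of s and q of t, the distance from [f p q] to v is at most a when the limit
    in n is taken first, and at least b when the limit in m is. *)
Lemma compact_double_limit (R : realType) (P Q : topologicalType)
    (f : P -> Q -> R) : compact [set: P] -> compact [set: Q] ->
  separately_continuous2 f -> double_limit_condition setT setT f.
Proof.
move=> cP cQ [cfx cfy] [s [t [v [a [b [_ ab small large]]]]]].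
have [p sp] := compact_cluster_point s cP.
have [q tq] := compact_cluster_point t cQ.
have : `|f p q - v| <= a.
  apply: (cluster_point_closed (n:=0) (C:=[set x | `|f x q - v| <= a]) _ sp).
    by apply: closed_lef; apply: distr_continuous; exact: cfy.
  move=> m _ _ ->.
  apply: (cluster_point_closed (n:=m.+1)
    (C:=[set y | `|f (s m) y - v| <= a]) _ tq).
    by apply: closed_lef; exact: distr_continuous.
  by move=> n mn _ -> /=; exact: small.
apply/negP; rewrite -ltNge (lt_le_trans ab)//.
apply: (cluster_point_closed (n:=0) (C:=[set y | b <= `|f p y - v|]) _ tq).
  by apply: closed_gef; exact: distr_continuous.
move=> n _ _ ->.
apply: (cluster_point_closed (n:=n.+1)
  (C:=[set x | b <= `|f x (t n) - v|]) _ sp).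
  by apply: closed_gef; apply: distr_continuous; exact: cfy.
by move=> m nm _ -> /=; exact: large.
Qed.

Lemma quasi_continuous2_comp (X Y Z T : topologicalType) (f : X -> Y -> Z)
    (g : Z -> T) : continuous g -> quasi_continuous2 f ->
  quasi_continuous2 (fun x y => g (f x y)).
Proof. by move=> cg qf x y O A B /cg; exact: (qf x y (g @^-1` O)). Qed.

(* If this fails, there are U_n containing x0, V_n and A_n, with f large on
   A_n * V_n, f (-, y_n) small on U_n for some y_n in V_n, and U_n, V_n
   decreasing, A_n.+1 in U_n.  The order in which cluster points are taken
   matters: first x of the A_n, then one of the V_n cut down to where f (x, -)
   is small. *)
Lemma quasi_continuous2_strong (R : realType) (X Y : topologicalType)
    (f : X -> Y -> R) (x0 : X) (O : set Y) (a b : R) :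
  feebly_compact X -> feebly_compact Y ->
  separately_continuous2 f -> quasi_continuous2 f ->
  open O -> O !=set0 -> a < b -> (forall y, O y -> f x0 y < a) ->
  exists U V, [/\ open U, U x0, open V /\ V !=set0, V `<=` O &
    forall x y, U x -> V y -> f x y < b].
Proof.
move=> fX fY [cfx cfy] qf oO O0 ab fO; apply: contrapT => nUV.
(* Since a < c < d < b, the sets where f (x, -) is below c contain the [y n], where it is at most a,
   while the bounds c and d still contradict each other in the limit. *)
pose d := (a + b) / 2; pose c := (a + d) / 2.
have ac : a < c by rewrite /c /d; lra.
have cd : c < d by rewrite /c /d; lra.
have db : d < b by rewrite /d; lra.
pose G (z : (set X * set Y) * (set X * Y)) :=
  [/\ open z.1.1 /\ z.1.1 x0, open z.1.2 /\ z.1.2 `<=` O,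
    open z.2.1 /\ z.2.1 !=set0, z.1.2 z.2.2 &
    (forall x y, z.2.1 x -> z.1.2 y -> d < f x y) /\
    (forall x, z.1.1 x -> f x z.2.2 < a)].
pose r (z z' : (set X * set Y) * (set X * Y)) :=
  [/\ z'.1.1 `<=` z.1.1, z'.1.2 `<=` z.1.2 & z'.2.1 `<=` z.1.1].
have next (U : set X) (V : set Y) : open U -> U x0 -> open V -> V !=set0 ->
    V `<=` O -> exists z, [/\ G z, z.1.1 `<=` U, z.1.2 `<=` V & z.2.1 `<=` U].
  move=> oU Ux0 oV V0 VO.
  have [x [y [Ux Vy bxy]]] : exists x y, [/\ U x, V y & b <= f x y].
    apply: contrapT => nxy; apply: nUV; exists U, V; split => // x y Ux Vy.
    by rewrite ltNge; apply/negP => bxy; apply: nxy; exists x, y.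
  (* Quasi-continuity at a point where f is at least b gives a box where f exceeds d. As y' lies in
     [O], [U] can be cut around x0 to where f (-, y') is below a. *)
  have [|||A [V' [[oA oV'] [A0 [y' V'y']] AU V'V fAV]]] :=
    qf x y [set u | d < u] U V.
  - by apply: open_nbhs_nbhs; split; [exact: open_gt|exact: lt_le_trans bxy].
  - exact: open_nbhs_nbhs.
  - exact: open_nbhs_nbhs.
  exists ((U `&` [set x | f x y' < a], V'), (A, y')); split => //=.
  split => //=; last by split => // ? [].
    split; first by apply: openI => //; exact: open_ltf.
    by split => //=; exact/fO/VO/V'V.
  by split => //; exact: subset_trans VO.
have [|||z zG zr] := @transitive_chain _ G r.
- move=> z1 z2 z3 [U12 V12 A12] [U23 V23 A23].
  by split; [exact: subset_trans U12|exact: subset_trans V12|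
             exact: subset_trans U12].
- by have [z [Gz _ _ _]] := next setT O openT I oO O0 (@subset_refl _ _);
    exists z.
- move=> z [[oU Ux0] [oV VO] _ Vy _].
  have [z' [Gz' ? ? ?]] := next _ _ oU Ux0 oV (ex_intro _ _ Vy) VO.
  by exists z'.
pose A n := (z n).2.1; pose V n := (z n).1.2; pose y n := (z n).2.2.
have [n|n|x Ax] := fX A; [by case: (zG n) => _ _ []..|].
have fxy n : f x (y n) <= a.
  apply: (cluster_point_closed (n:=n.+1) (C:=[set x | f x (y n) <= a]) _ Ax).
    exact: closed_lef.
  move=> m nm x' Ax'; have [_ _ Am] := zr _ _ nm.
  by have [_ _ _ _ [_ /(_ _ (Am _ Ax'))/ltW]] := zG n.
have [n|n|y' Vy'] := fY (fun n => V n `&` [set y | f x y < c]).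
- by apply: openI; [case: (zG n) => _ []|exact: open_ltf].
- exists (y n); split; first by case: (zG n).
  exact: le_lt_trans (fxy n) ac.
have : f x y' <= c.
  apply: (cluster_point_closed (n:=0) (C:=[set y | f x y <= c]) _ Vy').
    exact: closed_lef.
  by move=> m _ u [_ /ltW].
apply/negP; rewrite -ltNge (lt_le_trans cd)//.
apply: (cluster_point_closed (n:=0) (C:=[set x | d <= f x y']) _ Ax).
  exact: closed_gef.
move=> m _ x' Ax' /=.
apply: (cluster_point_closed (n:=m.+1) (C:=[set y | d <= f x' y]) _ Vy').
  exact: closed_gef.
move=> n mn u [Vu _]; have [_ Vn _] := zr _ _ mn.
by have [_ _ _ _ [/(_ _ _ Ax' (Vn _ Vu))/ltW]] := zG m.
Qed.

(* At a point x0 of discontinuity, the previous lemma gives decreasing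
   neighborhoods Q_n of q and U_n of x0, open sets V_n.+1 in Q_n on which f is
   small over U_n.+1, and x_n in U_n with f (x_n, -) large on Q_n.  Take a
   cluster point y of the V_n, then one of the U_n cut down to where f (-, y) is
   large. *)
Lemma quasi_continuous2_extension (R : realType) (X Y K : topologicalType)
    (f : X -> Y -> R) (i : Y -> K) (fh : X -> K -> R) (q : K) :
  feebly_compact X -> feebly_compact Y ->
  separately_continuous2 f -> quasi_continuous2 f ->
  continuous i -> (forall (p : K) W, nbhs p W -> exists y, W (i y)) ->
  (forall x, continuous (fh x)) -> (forall x y, fh x (i y) = f x y) ->
  continuous (fh^~ q).
Proof.
move=> fX fY cf qf ci di cfh fhi x0; apply/cvgrPdist_lt => e e0.
apply: contrapT => nnear; pose v := fh x0 q.
have next0 (U : set X) : open U -> U x0 ->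
    exists2 x, U x & e <= `|fh x q - v|.
  move=> oU Ux0; apply: contrapT => nx; apply: nnear.
  apply: (@filterS _ _ _ U); last exact: open_nbhs_nbhs.
  move=> x Ux; rewrite distrC ltNge; apply/negP => ex; apply: nx; by exists x.
pose g x y := `|f x y - v|.
have cd : continuous (fun r : R => `|r - v|).
  by apply: distr_continuous => ?; exact: cvg_id.
have cg : separately_continuous2 g.
  by split=> u; apply: distr_continuous; [exact: cf.1|exact: cf.2].
have qg : quasi_continuous2 g by exact: quasi_continuous2_comp cd qf.
pose G (z : (set K * set X) * (set Y * X)) :=
  [/\ open z.1.1 /\ z.1.1 q, [/\ open z.1.2, z.1.2 x0 & z.1.2 z.2.2],
    open z.2.1 /\ z.2.1 !=set0,
    forall x y, z.1.2 x -> z.2.1 y -> g x y < e / 2 &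
    forall p, z.1.1 p -> 3 * e / 4 < `|fh z.2.2 p - v|].
pose r (z z' : (set K * set X) * (set Y * X)) :=
  [/\ z'.1.1 `<=` z.1.1, z'.1.2 `<=` z.1.2 & z'.2.1 `<=` i @^-1` z.1.1].
have next (Q : set K) (U : set X) : open Q -> Q q -> open U -> U x0 ->
    exists z, [/\ G z, z.1.1 `<=` Q, z.1.2 `<=` U & z.2.1 `<=` i @^-1` Q].
  (* Over [Q'] the function at x0 is within e / 4 of v, which [quasi_continuous2_strong] turns into
     the bound e / 2 on a box whose first side contains x0. *)
  move=> oQ Qq oU Ux0; pose Q' := Q `&` [set p | `|fh x0 p - v| < e / 4].
  have oQ' : open Q' by apply: openI => //; apply/open_ltf/distr_continuous.
  have Q'q : Q' q by split => //=; rewrite subrr normr0 divr_gt0.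
  have [||||U' [V [oU' U'x0 oV VQ gUV]]] :=
    @quasi_continuous2_strong R X Y g x0 (i @^-1` Q') (e / 4) (e / 2) fX fY cg qg.
  - by apply: open_comp => // y _; exact: ci.
  - by have [y] := di _ _ (open_nbhs_nbhs (conj oQ' Q'q)); exists y.
  - lra.
  - by move=> y [_ /=]; rewrite fhi.
  have [||x [Ux U'x] ex] := next0 (U `&` U'); [exact: openI|by []|].
  exists ((Q `&` [set p | 3 * e / 4 < `|fh x p - v|], U `&` U'), (V, x)).
  split => //=; last by move=> y /VQ[].
  split => //=.
  - split; last by split => //=; lra.
    by apply: openI => //; apply/open_gtf/distr_continuous.
  - by split => //; exact: openI.
  - by move=> x' y [_ U'x']; exact: gUV.
  - by move=> p [].
have [|||z zG zr] := @transitive_chain _ G r.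
- move=> z1 z2 z3 [Q12 U12 V12] [Q23 U23 V23].
  split; [exact: subset_trans Q12|exact: subset_trans U12|].
  by move=> y /V23/Q12.
- by have [z [Gz _ _ _]] := next setT setT openT I openT I; exists z.
- move=> z [[oQ Qq] [oU Ux0 _] _ _ _].
  by have [z' [Gz' ? ? ?]] := next _ _ oQ Qq oU Ux0; exists z'.
pose V n := (z n).2.1; pose U n := (z n).1.2; pose x n := (z n).2.2.
have [n|n|y Vy] := fY V; [by case: (zG n) => _ _ []..|].
have gxy n : 3 * e / 4 <= g (x n) y.
  apply: (cluster_point_closed (n:=n.+1)
    (C:=[set y | 3 * e / 4 <= g (x n) y]) _ Vy).
    exact/closed_gef/cg.1.
  move=> m nm y' Vy'; have [_ _ /(_ _ Vy') Q] := zr _ _ nm.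
  by have [_ _ _ _ /(_ _ Q)] := zG n; rewrite fhi => /ltW.
(* The level 5e / 8 separates 3e / 4, reached at the [x n], from e / 2, the bound obtained in the
   limit from the boxes. *)
have [n|n|x' Ux'] := fX (fun n => U n `&` [set x | 5 * e / 8 < g x y]).
- apply: openI; first by case: (zG n) => _ [].
  exact/open_gtf/cg.2.
- exists (x n); split; first by case: (zG n) => _ [].
  by apply: lt_le_trans (gxy n); lra.
have : g x' y <= e / 2.
  apply: (cluster_point_closed (n:=0) (C:=[set y | g x' y <= e / 2]) _ Vy).
    exact/closed_lef/cg.1.
  move=> n _ y' Vy' /=.
  apply: (cluster_point_closed (n:=n.+1) (C:=[set x | g x y' <= e / 2]) _ Ux').
    exact/closed_lef/cg.2.
  move=> m nm u [Uu _]; have [_ Um _] := zr _ _ nm.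
  by have [_ _ _ /(_ _ _ (Um _ Uu) Vy')/ltW] := zG n.
have : 5 * e / 8 <= g x' y.
  apply: (cluster_point_closed (n:=0) (C:=[set x | 5 * e / 8 <= g x y]) _ Ux').
    exact/closed_gef/cg.2.
  by move=> m _ u [_ /ltW].
lra.
Qed.

(** With cluster points p in beta X of s and q in beta Y of t, fh (-, q) is continuous and extends
    to h on beta X. An x in X that agrees with p for h and for the extensions of all f (-, t n) can
    replace p, and both iterated limits become [fh x q]. *)
Lemma quasi_continuous2_double_limit (R : realType) (X Y : topologicalType)
    (f : X -> Y -> R) :
  feebly_compact X -> feebly_compact Y ->
  separately_continuous2 f -> quasi_continuous2 f ->
  (forall x y, 0 <= f x y <= 1) -> double_limit_condition setT setT f.
Proof.
move=> fX fY cf qf f01 [s [t [v [a [b [_ ab small large]]]]]].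
have [fh fhP] := choice (fun x => stone_cech_extension (cf.1 x) (f01 x)).
have [q tq] := compact_cluster_point (to_stone_cech R \o t)
  (@compact_stone_cech R Y).
have [p sp] := compact_cluster_point (to_stone_cech R \o s)
  (@compact_stone_cech R X).
have cfh x : continuous (fh x) by case: (fhP x).
have fhi x y : fh x (to_stone_cech R y) = f x y by case: (fhP x).
have fh01 x p' : 0 <= fh x p' <= 1 by case: (fhP x).
have cq : continuous (fh^~ q).
  apply: (@quasi_continuous2_extension R X Y _ f (to_stone_cech R (X:=Y)) fh) => //.
    exact: to_stone_cech_continuous.
  exact: to_stone_cech_dense.
have [h [ch hE _]] := stone_cech_extension cq (fh01^~ q).
have [k kP] := choice (fun n => stone_cech_extension (cf.2 (t n)) (f01^~ (t n))).
have ck n : continuous (k n) by case: (kP n).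
have kE n x : k n (to_stone_cech R x) = f x (t n) by case: (kP n).
(* Index 0 stands for h and index n + 1 for the extension of f (-, t n). *)
have [|x hkx] := @stone_cech_countable_approx R X
  (fun n => if n is m.+1 then k m else h) p fX.
  by move=> [|n].
have : `|fh x q - v| <= a.
  rewrite -hE (hkx 0%N).
  apply: (cluster_point_closed (n:=0) (C:=[set p | `|h p - v| <= a]) _ sp).
    exact/closed_lef/distr_continuous.
  move=> m _ _ -> /=; rewrite hE.
  apply: (cluster_point_closed (n:=m.+1)
    (C:=[set q | `|fh (s m) q - v| <= a]) _ tq).
    exact/closed_lef/distr_continuous.
  by move=> n mn _ -> /=; rewrite fhi small.
apply/negP; rewrite -ltNge (lt_le_trans ab)//.
apply: (cluster_point_closed (n:=0) (C:=[set q | b <= `|fh x q - v|]) _ tq).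
  exact/closed_gef/distr_continuous.
move=> n _ _ -> /=; rewrite fhi -kE (hkx n.+1).
apply: (cluster_point_closed (n:=n.+1) (C:=[set p | b <= `|k n p - v|]) _ sp).
  exact/closed_gef/distr_continuous.
by move=> m nm _ -> /=; rewrite kE large.
Qed.

(* The value at q is a limit of [k s q] along the s which agree with u on more
   and more points of D; by the double limit condition, u tends to it at q. *)
Lemma double_limit_extension (R : realType) (K : topologicalType) (S : Type)
    (A : set S) (D : set K) (k : S -> K -> R) (u : K -> R) :
  (forall s, A s -> continuous (k s)) ->
  (forall s q, A s -> 0 <= k s q <= 1) -> closure D = setT ->
  (forall l : seq K, (forall t, t \in l -> D t) ->
    exists2 s, A s & forall t, t \in l -> k s t = u t) ->
  double_limit_condition A D k ->
  exists2 h : K -> R, continuous h & forall t, D t -> h t = u t.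
Proof.
move=> ck k01 dD appr dl.
have /choice[h hP] (q : K) : exists v : R, forall e, 0 < e ->
    forall l : seq K, (forall t, t \in l -> D t) ->
    exists s, [/\ A s, forall t, t \in l -> k s t = u t & `|k s q - v| < e].
  (* The values at q of those [k s] that agree with u on a finite list generate a filter on [0, 1];
     [h q] is one of its cluster points. *)
  pose F := filter_from [set l : seq K | forall t, t \in l -> D t]
    (fun l => [set k s q | s in [set s | A s /\ forall t, t \in l -> k s t = u t]]).
  have FF : ProperFilter F.
    apply: filter_from_proper; last first.
      by move=> l /appr[s As sl]; exists (k s q), s.
    apply: filter_from_filter; first by exists [::].
    move=> l1 l2 Dl1 Dl2; exists (l1 ++ l2) => /= [t|_ [s [As sl] <-]].
      by rewrite mem_cat => /orP[/Dl1|/Dl2].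
    split; exists s => //; split => // t tl; apply: sl; rewrite mem_cat tl//.
    by rewrite orbT.
  have [|v [_ clv]] := @segment_compact R 0 1 F FF.
    by exists [::] => // _ [s [As _] <-]; rewrite /= in_itv; exact: k01.
  exists v => e e0 l Dl.
  have Fl : F [set k s q | s in [set s | A s /\ forall t, t \in l -> k s t = u t]].
    by exists l.
  have [_ [[s [As sl] <-] sv]] := clv _ _ Fl (nbhsx_ballx v e e0).
  by exists s; split => //; move: sv; rewrite -ball_normE /= distrC.
have hu (q : K) (e : R) : 0 < e -> nbhs q [set t | D t -> `|u t - h q| < e].
  move=> e0; apply: contrapT => nq; apply: dl.
  have far (Q : set K) : open Q -> Q q ->
      exists t, [/\ Q t, D t & e <= `|u t - h q|].
    move=> oQ Qq; apply: contrapT => nt; apply: nq.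
    apply: (@filterS _ _ _ Q); last exact: open_nbhs_nbhs.
    move=> t Qt Dt; rewrite ltNge; apply/negP => et.
    by apply: nt; exists t.
  (* A stage is ((l, Q), (s, t)): l collects all t so far and [Q] is where [k s] stays near [h q].
     Later s agree with u on l, where u t is far from [h q], and later t lie in [Q]. *)
  pose G (z : (seq K * set K) * (S * K)) :=
    [/\ forall t, t \in z.1.1 -> D t, open z.1.2 /\ z.1.2 q,
      A z.2.1 /\ z.2.2 \in z.1.1,
      forall t, z.1.2 t -> `|k z.2.1 t - h q| < e / 2 &
      e <= `|u z.2.2 - h q|].
  pose r (z z' : (seq K * set K) * (S * K)) :=
    [/\ {subset z.1.1 <= z'.1.1}, z'.1.2 `<=` z.1.2, z.1.2 z'.2.2 &
      forall t, t \in z.1.1 -> k z'.2.1 t = u t].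
  have next (l : seq K) (Q : set K) : (forall t, t \in l -> D t) ->
      open Q -> Q q -> exists z, [/\ G z, {subset l <= z.1.1}, z.1.2 `<=` Q,
        Q z.2.2 & forall t, t \in l -> k z.2.1 t = u t].
    move=> Dl oQ Qq; have [|s [As sl sq]] := hP q (e / 2) _ l Dl.
      exact: divr_gt0.
    pose Q' := Q `&` [set t | `|k s t - h q| < e / 2].
    have oQ' : open Q'.
      by apply: openI => //; apply/open_ltf/distr_continuous/ck.
    have [t [Qt Dt et]] := far Q oQ Qq.
    exists ((t :: l, Q'), (s, t)); split => /=; [|by move=> w lw; rewrite inE lw orbT|
      by move=> ? []|by []|by []].
    by split => /=; [move=> w; rewrite inE => /orP[/eqP->|/Dl]|split|
      rewrite mem_head|move=> ? []|].
  have [|||z zG zr] := @transitive_chain _ G r.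
  - move=> z1 z2 z3 [l12 Q12 t12 s12] [l23 Q23 t23 s23]; split.
    + by move=> w lw; exact/l23/l12.
    + exact: subset_trans Q12.
    + exact: Q12.
    + by move=> w lw; exact/s23/l12.
  - by have [//|z [Gz _ _ _ _]] := next [::] setT _ openT I; exists z.
  - move=> z [Dl [oQ Qq] _ _ _].
    by have [z' [Gz' ? ? ? ?]] := next _ _ Dl oQ Qq; exists z'.
  exists (fun n => (z n).2.1), (fun n => (z n).2.2), (h q), (e / 2), e.
  split => [n||m n mn|m n nm]; last 2 first.
  - by have [_ _ Qt _] := zr _ _ mn; have [_ _ _ /(_ _ Qt)/ltW] := zG m.
  - have [_ _ _ sm] := zr _ _ nm; have [_ _ [_ tl] _ et] := zG n.
    by rewrite sm.
  - by have [Dl _ [As /Dl]] := zG n.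
  - by rewrite ltr_pdivrMr// ltr_pMr// ltr1n.
exists h => [q|t Dt].
  apply/cvgrPdist_lt => e e0; have e2 : 0 < e / 2 by exact: divr_gt0.
  have := hu q _ e2; rewrite nbhsE => -[V [oV Vq] Vu].
  apply: (@filterS _ _ _ V); last exact: open_nbhs_nbhs.
  move=> q' Vq'; have : closure D q' by rewrite dD.
  move=> /(_ _ (filterI (open_nbhs_nbhs (conj oV Vq')) (hu q' _ e2))).
  move=> [t [Dt [/Vu/(_ Dt) tq /(_ Dt) tq']]].
  rewrite -(subrK (u t) (h q)) -addrA (splitr e) (le_lt_trans (ler_normD _ _))//.
  by rewrite ltrD// distrC.
apply/eqP; rewrite eq_sym -subr_eq0 -normr_le0; apply/ler_addgt0Pr => e e0.
by rewrite add0r ltW// (nbhs_singleton (hu t e e0)).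
Qed.

(** * Dieudonné complete subspaces *)

Lemma entourage_halve (U : uniformType) (E : set (U * U)) : entourage E ->
  exists E' : set (U * U), [/\ entourage E', forall x y, E' (x, y) -> E' (y, x) &
    forall x y z, E' (x, y) -> E' (y, z) -> E (x, z)].
Proof.
move=> entE; have sE := entourage_split_ent entE.
exists (split_ent E `&` (split_ent E)^-1)%relation; split.
- by apply: filterI => //; exact: entourage_inv.
- by move=> x y [].
- by move=> x y z [xy _] [yz _]; exact: entourage_split yz.
Qed.

(** Take an ultrafilter [G] on X finer than the trace of the neighborhoods of p. Its image is
    Cauchy, so it converges in M, and by continuity of g the limit is [g p]. *)
Lemma dieudonne_complete_stone_cech_range (R : realType)
    (X T : topologicalType) (M : set T) (g : stone_cech R X -> T) :
  feebly_compact X -> hausdorff_space T -> dieudonne_complete (set_type M) ->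
  continuous g -> (forall x, M (g (to_stone_cech R x))) -> forall p, M (g p).
Proof.
move=> fX hT [uT [nbE complete]] cg gM p.
pose U := Uniform.Pack uT.
pose f (x : X) : U := exist _ (g (to_stone_cech R x)) (mem_set (gM x)).
have cf (x : X) (B : set U) : nbhs (f x) B -> nbhs x (f @^-1` B).
  rewrite nbE => -[_ [[V oV <-] Vx VB]].
  apply: (@filterS _ (nbhs x) _ ((g \o to_stone_cech R (X:=X)) @^-1` V)).
    by move=> x' Vx'; exact: VB.
  apply: (continuous_comp (@to_stone_cech_continuous R X x) (cg _)).
  exact: open_nbhs_nbhs.
pose F := filter_from (nbhs p) (fun W => to_stone_cech R (X:=X) @^-1` W).
have FF : ProperFilter F.
  apply: filter_from_proper; last exact: to_stone_cech_dense.
  apply: filter_from_filter; first by exists setT; exact: filterT.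
  by move=> A B pA pB; exists (A `&` B) => //; exact: filterI.
have [G [UG FG]] := ultraFilterLemma FF.
have [|y Gy] := complete (f @ G) _.
  move=> E entE; have [E1 [entE1 symE1 E1E]] := entourage_halve entE.
  have [[x Gx]|nx] := pselect (exists x, G [set y | E1 (f x, f y)]).
    exists ([set y | E1 (f x, y)], [set y | E1 (f x, y)]) => //.
    by move=> [y z] [/= xy xz]; exact: E1E (symE1 _ _ xy) xz.
  (* No E1-ball around a value of f is large for [G], so by maximality the complements are, and
     points that are pairwise not E1-close can be picked. *)
  exfalso.
  have Gn x : G [set y | ~ E1 (f x, f y)].
    by have [Gx|//] := in_ultra_setVsetC [set y | E1 (f x, f y)] UG;
      case: nx; exists x.
  pose Q (z : set X * X) := G z.1 /\ forall y, z.1 y -> ~ E1 (f z.2, f y).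
  pose r (z z' : set X * X) := z'.1 `<=` z.1 /\ z.1 z'.2.
  have next P : G P -> exists z, [/\ Q z, z.1 `<=` P & P z.2].
    move=> GP; have [x Px] := @filter_ex _ G _ _ GP.
    exists (P `&` [set y | ~ E1 (f x, f y)], x); split => //=.
    by split => [|y []//]; exact: filterI.
  have [|||z zQ zr] := @transitive_chain _ Q r.
  - move=> z1 z2 z3 [P12 x12] [P23 x23].
    by split; [exact: subset_trans P12|exact: P12].
  - by have [z [Qz _ _]] := next setT filterT; exists z.
  - by move=> z [/next[z' [Qz' ? ?]] _]; exists z'.
  have [E2 [entE2 symE2 E2E1]] := entourage_halve entE1.
  have [E3 [entE3 symE3 E3E2]] := entourage_halve entE2.
  have near3 x : nbhs x [set y | E3 (f x, f y)].
    apply: (cf x [set y | E3 (f x, y)]); apply/nbhsP; exists E3 => //.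
    by move=> y /xsectionP.
  have [n|n|x clx] := fX (fun n => [set y | E3 (f (z n).2, f y)]°).
  - exact: open_interior.
  - by exists (z n).2; exact: near3.
  (* Two of these open sets, with distinct indices, meet the E3-neighborhood of x; their centers are
     then joined by four E3-steps, hence E1-close. *)
  have [m _ [y [/interior_subset/= my /= xy]]] := clx _ (near3 x) 0%N.
  have [n mn [y' [/interior_subset/= ny' /= xy']]] := clx _ (near3 x) m.+1.
  have [_ /(_ (z n).2)] := zQ m; apply; first exact: (zr _ _ mn).2.
  apply: (E2E1 _ (f x)); apply: E3E2; [exact: my|exact: symE3|exact: xy'|].
  exact: symE3.
have GgT : (g \o to_stone_cech R (X:=X)) @ G --> set_val (y : set_type M).
  move=> B yB; apply: (Gy (set_val @^-1` B)); rewrite nbE.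
  exact: (@initial_continuous (set_type M) T set_val).
have Ggp : (g \o to_stone_cech R (X:=X)) @ G --> g p.
  by move=> B /cg pB; apply: FG; exists (g @^-1` B).
rewrite (cvg_unique hT Ggp GgT).
exact: (set_mem (valP (y : set_type M))).
Qed.

(** * Extension one coordinate at a time *)

Section dfwith_lemmas.
Variables (I : eqType) (K : I -> Type).
Implicit Type x : forall i, K i.

Lemma dfwith_same x (i : I) (s t : K i) :
  dfwith (dfwith x i s) i t = dfwith x i t.
Proof.
apply: functional_extensionality_dep => j.
by case: (eqVneq i j) t => [<- t|ij t]; rewrite ?dfwithin ?dfwithout.
Qed.

Lemma dfwith_swap x (i j : I) (s : K i) (t : K j) : i != j ->
  dfwith (dfwith x i s) j t = dfwith (dfwith x j t) i s.
Proof.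
move=> ij; apply: functional_extensionality_dep => k.
have [ik|ik] := eqVneq i k; last have [jk|jk] := eqVneq j k.
- by case: _ / ik; rewrite dfwithin dfwithout 1?eq_sym// dfwithin.
- by case: _ / jk; rewrite dfwithin dfwithout// dfwithin.
- by rewrite !dfwithout.
Qed.

Lemma dfwith_id x (i : I) : dfwith x i (x i) = x.
Proof.
apply: functional_extensionality_dep => j.
by have [<-|ij] := eqVneq i j; rewrite ?dfwithin ?dfwithout.
Qed.

Lemma dfwith_in (D : forall i, set (K i)) x (i : I) (t : K i) :
  (forall j, j != i -> D j (x j)) -> D i t -> forall j, D j (dfwith x i t j).
Proof.
by move=> Dx Dt j; case: dfwithP => // j' ij; apply: Dx; rewrite eq_sym.
Qed.

End dfwith_lemmas.

Section extend_coordinate.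
Variables (R : realType) (I : eqType) (K : I -> topologicalType).
Implicit Types (D : forall i, set (K i)) (f : (forall i, K i) -> R).

(** By [stone_cech_countable_approx] the image of a feebly compact X in beta X has this property. *)
Definition countably_dense (T : topologicalType) (A : set T) :=
  forall (h : nat -> T -> R) (p : T), (forall n, continuous (h n)) ->
  exists2 q, A q & forall n, h n q = h n p.

(** Like [sections_double_limit], this only involves values of f at points with all coordinates in
    D, so f may be arbitrary elsewhere. *)
Definition sections_extend D f := forall x, (forall i, D i (x i)) ->
  forall i, exists2 h : K i -> R, continuous h &
    forall t, D i t -> h t = f (dfwith x i t).

Definition sections_double_limit D f := forall x, (forall i, D i (x i)) ->
  forall i j, i != j -> double_limit_condition (D i) (D j)
    (fun s t => f (dfwith (dfwith x i s) j t)).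

Lemma countably_dense_eq (T : topologicalType) (A : set T) (g h : T -> R) :
  countably_dense A -> continuous g -> continuous h ->
  (forall t, A t -> g t = h t) -> g = h.
Proof.
move=> dA cg ch gh; apply/funext => t.
have [|s As st] := dA (fun n => if n is 0%N then g else h) t; first by case.
by rewrite -(st 0%N) -(st 1%N) gh.
Qed.

(* [D] keeps track of the coordinates that have been extended: [D i] is the
   range of X_i before, and everything after, the extension to beta X_i. *)
Lemma extend_coordinate D D' f (i0 : I) :
  (forall i, closure (D i) = setT) -> (forall i, countably_dense (D i)) ->
  (forall i, i != i0 -> D' i = D i) -> D' i0 = setT ->
  (forall x, (forall i, D i (x i)) -> 0 <= f x <= 1) ->
  sections_extend D f -> sections_double_limit D f ->
  exists g : (forall i, K i) -> R,
    [/\ forall x, (forall i, D i (x i)) -> g x = f x,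
        forall x, (forall i, D' i (x i)) -> 0 <= g x <= 1,
        sections_extend D' g & sections_double_limit D' g].
Proof.
move=> clD dD D'E D'T f01 ef dlf.
pose off (x : forall i, K i) := forall i, i != i0 -> D i (x i).
have offD x t : off x -> D i0 t -> forall i, D i (dfwith x i0 t i).
  by move=> ox Dt; exact: dfwith_in.
have D'off x : (forall i, D' i (x i)) -> off x.
  by move=> D'x i ii0; rewrite -D'E.
have [h hP] : {h : (forall i, K i) -> K i0 -> R & forall x, off x ->
    continuous (h x) /\ forall t, D i0 t -> h x t = f (dfwith x i0 t)}.
  apply: (@choice _ _ (fun x h => off x -> continuous h /\
    forall t, D i0 t -> h t = f (dfwith x i0 t))) => x.
  have [ox|nox] := pselect (off x); last by exists (fun=> 0).
  have [|s Ds _] := dD i0 (fun _ _ => 0) (x i0).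
    by move=> _; exact: cst_continuous.
  have [h ch hE] := ef _ (offD x s ox Ds) i0.
  by exists h => _; split => // t Dt; rewrite hE// dfwith_same.
pose g x := h x (x i0).
have off_dfwith0 x t : off x -> off (dfwith x i0 t).
  by move=> ox i ii0; rewrite dfwithout 1?eq_sym//; exact: ox.
have off_dfwith x j t : off x -> D j t -> off (dfwith x j t).
  by move=> ox Dt i; case: dfwithP => // j' _; exact: ox.
(* The choice of [h x] could depend on the coordinate i0 of x; uniqueness of continuous extensions
   from [D i0] rules this out. *)
have gE x t : off x -> g (dfwith x i0 t) = h x t.
  move=> ox; rewrite /g dfwithin; congr (_ t).
  have [c1 e1] := hP _ ox; have [c2 e2] := hP _ (off_dfwith0 x t ox).
  apply: (countably_dense_eq (dD i0)) => // s Ds.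
  by rewrite e1// e2// dfwith_same.
(* Countably many values of g at a common i0-coordinate p are values of f at one p' in [D i0];
   everything that follows reduces to this. *)
have approx (y : nat -> forall i, K i) (p : K i0) : (forall n, off (y n)) ->
    exists2 p', D i0 p' & forall n, f (dfwith (y n) i0 p') = g (dfwith (y n) i0 p).
  move=> oy; have [n|p' Dp' hp'] := dD i0 (fun n => h (y n)) p.
    exact: (hP _ (oy n)).1.
  by exists p' => // n; rewrite gE// -hp' (hP _ (oy n)).2.
exists g; split.
- by move=> x Dx; rewrite -[x](dfwith_id x i0) gE// (hP x _).2.
- move=> x /D'off ox; have [//|p' Dp' /(_ 0%N)] := approx (fun=> x) (x i0).
  by rewrite dfwith_id => <-; apply: f01; exact: offD.
- move=> x /D'off ox j; have [->|ji0] := eqVneq j i0.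
    by exists (h x) => [|t _]; [exact: (hP x ox).1|rewrite gE].
  have [k kP] : {k : K i0 -> K j -> R & forall s, D i0 s -> continuous (k s) /\
      forall t, D j t -> k s t = f (dfwith (dfwith x i0 s) j t)}.
    apply: (@choice _ _ (fun s k => D i0 s -> continuous k /\
      forall t, D j t -> k t = f (dfwith (dfwith x i0 s) j t))) => s.
    have [Ds|nDs] := pselect (D i0 s); last by exists (fun=> 0).
    by have [k ck kE] := ef _ (offD x s ox Ds) j; exists k.
  rewrite D'E//.
  (* On finite sets the section of g in direction j agrees with sections of f through some s in
     [D i0], and these extend continuously to [K j]. *)
  apply: (@double_limit_extension R (K j) (K i0) (D i0) (D j) k) => //.
  + by move=> s /kP[].
  + move=> s q Ds; have [_|q' Dq' /(_ 0%N) <-] := dD j (fun=> k s) q.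
      by case: (kP s Ds).
    rewrite (kP s Ds).2//; apply: f01; apply: dfwith_in => // i _.
    exact: offD.
  + move=> l Dl; pose y n := dfwith x j (nth (x j) l n).
    have [n|s Ds sE] := approx y (x i0).
      apply: off_dfwith => //; have [ln|nl] := ltnP n (size l).
        by apply: Dl; exact: mem_nth.
      by rewrite nth_default//; exact: ox.
    exists s => // t tl; rewrite (kP s Ds).2; last exact: Dl.
    rewrite dfwith_swap 1?eq_sym//; have := sE (index t l).
    rewrite /y nth_index// => ->; congr g.
    by rewrite -[RHS](dfwith_id _ i0) (dfwithout _ _ ji0).
  + move=> [s [t [v [a [b [DD ab small large]]]]]].
    apply: (dlf _ (offD x (s 0%N) ox (DD 0%N).1) i0 j); first by rewrite eq_sym.
    exists s, t, v, a, b; split => // m n mn; rewrite dfwith_same.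
      by rewrite -(kP _ (DD m).1).2 ?small//; case: (DD n).
    by rewrite -(kP _ (DD m).1).2 ?large//; case: (DD n).
move=> x D'x i j ij [s [t [v [a [b [DD ab small large]]]]]].
have ox := D'off _ D'x.
(* A violation for g becomes one for f as soon as the whole double array of values is realized
   inside D. *)
suff [x' [s' [t' [Dx' DD' E]]]] : exists x' s' t', [/\ forall k, D k (x' k),
    forall n, D i (s' n) /\ D j (t' n) & forall m n,
    f (dfwith (dfwith x' i (s' m)) j (t' n)) =
    g (dfwith (dfwith x i (s m)) j (t n))].
  apply: (dlf x' Dx' i j ij); exists s', t', v, a, b.
  by split => // m n mn; rewrite E; [exact: small|exact: large].
have [ii0|ii0] := eqVneq i i0.
  subst i; have Dt n : D j (t n) by rewrite -D'E 1?eq_sym//; case: (DD n).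
  have /choice[s' s'P] m : exists q, D i0 q /\ forall n,
      f (dfwith (dfwith x i0 q) j (t n)) =
      g (dfwith (dfwith x i0 (s m)) j (t n)).
    have [n|q Dq qE] := approx (fun n => dfwith x j (t n)) (s m).
      exact: off_dfwith.
    by exists q; split => // n; rewrite dfwith_swap// qE -dfwith_swap.
  (* The i0-coordinate of the base point is overwritten anyway; [s' 0] only serves to put it in
     [D i0]. *)
  exists (dfwith x i0 (s' 0%N)), s', t; split.
  + by apply: offD => //; case: (s'P 0%N).
  + by move=> n; split => //; case: (s'P n).
  + by move=> m n; rewrite dfwith_same (s'P m).2.
have Ds n : D i (s n) by rewrite -D'E//; case: (DD n).
have [ji0|ji0] := eqVneq j i0.
  subst j; have /choice[t' t'P] n : exists q, D i0 q /\ forall m,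
      f (dfwith (dfwith x i (s m)) i0 q) =
      g (dfwith (dfwith x i (s m)) i0 (t n)).
    have [m|q Dq qE] := approx (fun m => dfwith x i (s m)) (t n).
      exact: off_dfwith.
    by exists q.
  exists (dfwith x i0 (t' 0%N)), s, t'; split.
  + by apply: offD => //; case: (t'P 0%N).
  + by move=> n; split => //; case: (t'P n).
  + move=> m n; rewrite (@dfwith_swap _ _ x i0 i) 1?eq_sym//.
    by rewrite dfwith_same (t'P n).2.
have Dt n : D j (t n) by rewrite -D'E//; case: (DD n).
(* When both i and j differ from i0, a single q must serve all pairs (m, n), which are enumerated
   through [pickle]. *)
pose st n : nat * nat := odflt (0%N, 0%N) (unpickle n).
have [n|q Dq qE] :=
  approx (fun n => dfwith (dfwith x i (s (st n).1)) j (t (st n).2)) (x i0).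
  exact: off_dfwith (off_dfwith _ _ _ ox (Ds _)) (Dt _).
exists (dfwith x i0 q), s, t; split => [|//|m n]; first exact: offD.
have := qE (pickle (m, n)); rewrite /st pickleK /=.
rewrite (@dfwith_swap _ _ _ j i0)// (@dfwith_swap _ _ x i i0)// => ->.
rewrite (@dfwith_swap _ _ _ j i0)// (@dfwith_swap _ _ x i i0)//.
by rewrite dfwith_id.
Qed.

End extend_coordinate.

Lemma extend_all_coordinates (R : realType) (I : finType)
    (K : I -> topologicalType) (D : forall i, set (K i))
    (f : (forall i, K i) -> R) :
  (forall i, closure (D i) = setT) -> (forall i, countably_dense R (D i)) ->
  (forall x, (forall i, D i (x i)) -> 0 <= f x <= 1) ->
  sections_extend D f -> sections_double_limit D f ->
  exists2 g : (forall i, K i) -> R, separately_continuous g &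
    forall x, (forall i, D i (x i)) -> g x = f x.
Proof.
move=> clD dD f01 ef dlf.
(* Coordinates in s are already extended and range over all of [K i]; the others are still confined
   to [D i]. *)
pose E (s : seq I) i : set (K i) := [set t | i \in s \/ D i t].
suff [g [gf _ eg _]] : exists g, [/\ forall x, (forall i, D i (x i)) -> g x = f x,
    forall x, (forall i, E (enum I) i (x i)) -> 0 <= g x <= 1,
    sections_extend (E (enum I)) g & sections_double_limit (E (enum I)) g].
  exists g => // x i.
  have ET j t : E (enum I) j t by left; rewrite mem_enum.
  have [h ch hE] := eg x (fun j => ET j (x j)) i.
  have -> : (fun t => g (dfwith x i t)) = h by apply/funext => t; rewrite hE.
  exact: ch.
elim: (enum I) => [|i0 s [g [gf g01 eg dlg]]].
  have -> : E [::] = D; last by exists f.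
  apply: functional_extensionality_dep => i; apply/seteqP; split => t //.
    by case.
  by right.
have DE i : D i `<=` E s i by move=> t; right.
have [i|i h p ch|i ii0||g' [g'g g'01 eg' dlg']] :=
  @extend_coordinate R I K (E s) (E (i0 :: s)) g i0 _ _ _ _ g01 eg dlg.
- by apply/seteqP; split => // t _; apply: (closureS (DE i)); rewrite clD.
- by have [q Dq qh] := dD i h p ch; exists q => //; exact: DE.
- apply/seteqP; rewrite /E; split => t /=; rewrite inE (negPf ii0)//.
- by apply/seteqP; split => // t _; left; rewrite mem_head.
by exists g'; split => // x Dx; rewrite g'g ?gf// => i; exact: DE.
Qed.

(** Separate continuity gives no control in the product topology, so properties are carried from
    points with coordinates in D to all points by freeing one coordinate at a time. *)
Lemma coordinatewise_dense (I : finType) (K : I -> Type)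
    (D : forall i, set (K i)) (P : (forall i, K i) -> Prop) :
  (forall x i, (forall t, D i t -> P (dfwith x i t)) ->
    forall t, P (dfwith x i t)) ->
  (forall x, (forall i, D i (x i)) -> P x) -> forall x, P x.
Proof.
move=> Pi PD x.
suff H (s : seq I) y : (forall i, i \notin s -> D i (y i)) -> P y.
  by apply: (H (enum I)) => i; rewrite mem_enum.
elim: s y => [y Dy|i0 s IH y Dy]; first by apply: PD => i; exact: Dy.
rewrite -(dfwith_id y i0); apply: Pi => t Dt; apply: IH => i.
case: dfwithP => // j i0j js; apply: Dy.
by rewrite inE negb_or eq_sym i0j.
Qed.

(** * Restrictions to a set of coordinates *)

Section glue.
Variables (I : finType) (X : I -> topologicalType) (B : {set I}).
Variables (xbar : forall i : {i | i \notin B}, X (sval i)).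
Implicit Type x : forall i : {i | i \in B}, X (sval i).

Lemma glue_in x (i : {i | i \in B}) : Defs.glue xbar x (sval i) = x i.
Proof.
case: i => i iB; rewrite /Defs.glue /=; case: {-}_ / boolP => iB'.
  by rewrite (bool_irrelevance iB' iB).
by case/negP: (iB').
Qed.

Lemma glue_notin x (i : {i | i \notin B}) :
  Defs.glue xbar x (sval i) = xbar i.
Proof.
case: i => i iB; rewrite /Defs.glue /=; case: {-}_ / boolP => iB'.
  by case/negP: (iB).
by rewrite (bool_irrelevance iB' iB).
Qed.

Lemma glue_dfwith x (i : {i | i \in B}) (t : X (sval i)) :
  Defs.glue xbar (dfwith x i t) = dfwith (Defs.glue xbar x) (sval i) t.
Proof.
apply: functional_extensionality_dep => j.
have [jB|jB] := boolP (j \in B).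
  have [ij|ij] := eqVneq i (exist _ j jB).
    subst i; rewrite dfwithin.
    by rewrite (glue_in _ (exist _ j jB)) dfwithin.
  rewrite (glue_in _ (exist _ j jB)) dfwithout// dfwithout.
    by rewrite (glue_in _ (exist _ j jB)).
  by apply: contra ij => /eqP ij; apply/eqP/val_inj.
rewrite (glue_notin _ (exist _ j jB)) dfwithout ?(glue_notin _ (exist _ j jB))//.
by apply: contraNneq jB => <-; exact: valP i.
Qed.

End glue.

Lemma map_glue (I : finType) (X Z : I -> topologicalType) (B : {set I})
    (g : forall i, X i -> Z i) (xbar : forall i : {i | i \notin B}, X (sval i))
    (x : forall i : {i | i \in B}, X (sval i)) :
  Defs.glue (fun i => g _ (xbar i)) (fun i => g _ (x i)) =
  fun i => g i (Defs.glue xbar x i).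
Proof.
apply: functional_extensionality_dep => j.
by rewrite /Defs.glue; case: {-}_ / boolP.
Qed.

Lemma map_dfwith (I : eqType) (X Z : I -> Type) (g : forall i, X i -> Z i)
    (x : forall i, X i) (i : I) (t : X i) :
  dfwith (fun j => g j (x j)) i (g i t) = fun j => g j (dfwith x i t j).
Proof.
apply: functional_extensionality_dep => j.
by case: (eqVneq i j) t => [<- t|ij t]; rewrite ?dfwithin ?dfwithout.
Qed.

Lemma dfwith2_continuous (I : eqType) (X : I -> topologicalType)
    (x : forall i, X i) (i j : I) : continuous
  (fun st : X i * X j => dfwith (dfwith x i st.1) j st.2 : prod_topology X).
Proof.
apply: prod_topology_continuous => k.
pose c st := dfwith (dfwith x i st.1) j st.2 k.
rewrite -/(continuous c); have [jk|jk] := eqVneq j k.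
  subst k; have -> : c = snd by apply/funext => st; rewrite /c dfwithin.
  by move=> st; exact: cvg_snd.
have [ik|ik] := eqVneq i k.
  subst k; have -> : c = fst.
    by apply/funext => st; rewrite /c dfwithout// dfwithin.
  by move=> st; exact: cvg_fst.
have -> : c = cst (x k) by apply/funext => st; rewrite /c !dfwithout.
exact: cst_continuous.
Qed.

Lemma continuous_set_type (T Z : topologicalType) (A : set Z)
    (f : T -> set_type A) : continuous (fun x => set_val (f x)) -> continuous f.
Proof.
move=> cf x W [_ [[V oV <-] Vx VW]].
apply: (@filterS _ _ _ ((fun y => set_val (f y)) @^-1` V)).
  by move=> y Vy; exact: VW.
exact: (cf x V (open_nbhs_nbhs (conj oV Vx))).
Qed.

(** * The implications between the three conditions *)

Lemma dieudonne_extension_beta_extendable (R : realType) (k : nat)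
    (I : finType) (X : I -> topologicalType) (Y : topologicalType)
    (Phi : (forall i, X i) -> Y) :
  extends_to_dieudonne_completion R Phi -> beta_extendable R k Phi.
Proof.
move=> [Ph [sPh PhE]] B _ xbar.
pose ib (i : {i | i \notin B}) := to_stone_cech R (xbar i).
pose gl := @Defs.glue I (fun i => stone_cech R (X i)) B ib.
exists (fun z => set_val (Ph (gl z))); split => [z i|x].
  have -> : (fun t => set_val (Ph (gl (dfwith z i t)))) =
      (fun t => set_val (Ph (dfwith (gl z) (sval i) t))).
    by apply/funext => t; rewrite /gl glue_dfwith.
  move=> t; apply: continuous_comp; first exact: sPh.
  exact: initial_continuous.
rewrite /restriction -PhE; congr (set_val (Ph _)).
exact: (map_glue (fun i => to_stone_cech R (X:=X i))).
Qed.

(** A bump phi at [r z] reduces the claim to the real function phi o r. For two coordinates this is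
    the restriction of a separately continuous function on a product of two compact spaces, so it
    inherits the double limit condition. *)
Lemma beta_extendable_quasicontinuous (R : realType) (I : finType)
    (X : I -> topologicalType) (Y : topologicalType)
    (Phi : (forall i, X i) -> Y) : completely_regular_space Y ->
  beta_extendable R 2 Phi -> quasicontinuous 2 Phi.
Proof.
move=> crY ext B B2 xbar z O W rO zW.
have [gh [sgh ghE]] := ext B B2 xbar.
set r := restriction Phi xbar in rO ghE *.
have [phi [cphi phi01 phi1 phi0]] := completely_regular_bump R crY rO.
have [ph [cph phE _]] := stone_cech_extension cphi phi01.
have {phi0} phiO w : 1 / 2 < phi (r w) -> O (r w).
  move=> h; apply: contrapT => /phi0 p0; move: h; rewrite p0; lra.
have phiE w : phi (r w) = ph (gh (fun i => to_stone_cech R (w i))).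
  by rewrite ghE phE.
pose iz i := to_stone_cech R (z i).
pose P : topologicalType :=
  prod_topology (fun k : {i | i \in B} => X (sval k)).
have pc k : continuous (fun w : P => w k) by exact: proj_continuous.
(* This settles B with at most one element, where phi o r is continuous. *)
have cont_qc : continuous (fun w => phi (r w)) -> exists U,
    [/\ open U, U !=set0, U `<=` W & r @` U `<=` O].
  move=> cr; exists (W° `&` [set w | 1 / 2 < phi (r w)]); split.
  - by apply: openI; [exact: open_interior|exact: open_gtf].
  - by exists z; split => //=; rewrite phi1; lra.
  - by move=> w [/interior_subset].
  - by move=> _ [w [_ /phiO ?] <-].
have [B0|[i iB]] := set_0Vmem B.
  apply: cont_qc; have -> : (fun w => phi (r w)) = cst (phi (r z)).
    apply/funext => w; congr (phi (r _)).
    by apply: functional_extensionality_dep => -[i iB]; exfalso; move: iB;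
       rewrite B0 inE.
  exact: cst_continuous.
pose i' : {i | i \in B} := exist _ i iB.
have [B1|[j /setD1P[ji jB]]] := set_0Vmem (B :\ i).
  apply: cont_qc.
  have -> : (fun w => phi (r w)) = fun w => ph (gh (dfwith iz i' (to_stone_cech R (w i')))).
    apply/funext => w; rewrite phiE; congr (ph (gh _)).
    apply: functional_extensionality_dep => k; case: dfwithP => // k' ik.
    exfalso; have : sval k' \in B :\ i; last by rewrite B1 inE.
    rewrite !inE (valP k') andbT; apply: contra ik => /eqP ik.
    by apply/eqP/val_inj.
  move=> w; apply: (continuous_comp (g:=ph)); last exact: cph.
  apply: (@continuous_comp _ _ _ (fun w : prod_topology _ => to_stone_cech R (w i'))
    (fun p => gh (dfwith iz i' p))); last exact: sgh.
  apply: (continuous_comp (g:=to_stone_cech R (X:=X i)));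
    last exact: to_stone_cech_continuous.
  exact: (pc i').
pose j' : {i | i \in B} := exist _ j jB.
have i'j' : i' != j' by apply: contra ji => /eqP/(congr1 val)/= ->.
have ij (k : {i | i \in B}) : k = i' \/ k = j'.
  apply: contrapT => /not_orP[ki kj].
  have : (0 < #|B :\ i :\ j|)%N.
    apply/card_gt0P; exists (sval k); rewrite !inE (valP k) andbT.
    by apply/andP; split; apply/eqP => kE; [apply: kj|apply: ki];
       exact: val_inj.
  have jBi : j \in B :\ i by rewrite !inE ji.
  by move: B2; rewrite (cardsD1 i) iB (cardsD1 j) jBi; case: #|_|.
(* [e] identifies pairs with points of the product over B; [eE] gives the inverse. *)
pose e (s : X i) (t : X j) : P :=
  dfwith (dfwith z i' s) j' t.
pose Fh p q := ph (gh (dfwith (dfwith iz i' p) j' q)).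
pose f s t := phi (r (e s t)).
have fE s t : f s t = Fh (to_stone_cech R s) (to_stone_cech R t).
  rewrite /f phiE /Fh; congr (ph (gh _)).
  rewrite -(map_dfwith (fun k => to_stone_cech R (X:=X (sval k)))).
  by rewrite -(map_dfwith (fun k => to_stone_cech R (X:=X (sval k)))).
have cFh : separately_continuous2 Fh.
  split => [p|q]; rewrite /Fh.
    by move=> q; apply: continuous_comp; [exact: sgh|exact: cph].
  have -> : (fun p => ph (gh (dfwith (dfwith iz i' p) j' q))) =
      (fun p => ph (gh (dfwith (dfwith iz j' q) i' p))).
    by apply/funext => p; rewrite dfwith_swap.
  by move=> p; apply: (continuous_comp (g:=ph)); [exact: sgh|exact: cph].
have qf : quasi_continuous2 f.
  apply: double_limit_quasi_continuous2.
    split => [s|t].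
      rewrite (_ : f s = fun t => Fh (to_stone_cech R s) (to_stone_cech R t));
        last by apply/funext.
      move=> t; apply: continuous_comp; first exact: to_stone_cech_continuous.
      exact: cFh.1.
    rewrite (_ : f^~ t = fun s => Fh (to_stone_cech R s) (to_stone_cech R t));
      last by apply/funext => s; exact: fE.
    move=> s; apply: (continuous_comp (g:=Fh^~ _)).
      exact: to_stone_cech_continuous.
    exact: cFh.2.
  move=> [s [t [v [a [b [_ ab small large]]]]]].
  apply: (compact_double_limit (@compact_stone_cech R _)
    (@compact_stone_cech R _) cFh).
  exists (to_stone_cech R \o s), (to_stone_cech R \o t), v, a, b.
  by split => // m n mn /=; rewrite -fE; [exact: small|exact: large].
have eE (w : P) : e (w i') (w j') = w.
  apply: functional_extensionality_dep => k.
  by case: (ij k) => ->; rewrite /e ?dfwithin// dfwithout 1?eq_sym// dfwithin.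
have := @dfwith2_continuous _ (fun k : {i | i \in B} => X (sval k)) z i' j'
  (z i', z j') W.
rewrite /= -/(e _ _) eE => /(_ zW)[[A C] /= [zA zC] AC].
have [|U [V [[oU oV] [[u Uu] [v Vv]] UA VC fUV]]] :=
  qf (z i') (z j') [set x | 1 / 2 < x] A C _ zA zC.
  apply: open_nbhs_nbhs; split; first exact: open_gt.
  by rewrite /= /f eE phi1; lra.
exists ([set w : P | U (w i')] `&` [set w : P | V (w j')]); split.
- by apply: openI; apply: open_comp => // w _; exact: pc.
- exists (e u v); split => /=; rewrite /e ?dfwithin//.
  by rewrite dfwithout 1?eq_sym// dfwithin.
- by move=> w [/UA Aw /VC Cw]; rewrite -(eE w); exact: (AC (w i', w j')).
- move=> _ [w [Uw Vw] <-]; apply: phiO.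
  by have := fUV _ _ Uw Vw; rewrite /f eE.
Qed.

(** The open set supplied by quasi-continuity over B = {i, j} contains a box around any of its
    points, since pairing the two coordinates is continuous. *)
Lemma quasicontinuous_pair (I : finType) (X : I -> topologicalType)
    (Y : topologicalType) (Phi : (forall i, X i) -> Y) (x : forall i, X i)
    (i j : I) : quasicontinuous 2 Phi -> i != j ->
  quasi_continuous2 (fun s t => Phi (dfwith (dfwith x i s) j t)).
Proof.
move=> qPhi ij s t O A C Ost sA tC; pose B := [set i; j]%SET.
have B2 : (#|B| <= 2)%N by rewrite cards2 ij.
have iB : i \in B by rewrite !inE eqxx.
have jB : j \in B by rewrite !inE eqxx orbT.
pose i' : {i | i \in B} := exist _ i iB.
pose j' : {i | i \in B} := exist _ j jB.
have ij' : i' != j' by apply: contra ij => /eqP/(congr1 val)/= ->.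
pose P : topologicalType :=
  prod_topology (fun k : {i | i \in B} => X (sval k)).
have pc k : continuous (fun w : P => w k) by exact: proj_continuous.
pose xbar (k : {k | k \notin B}) := x (sval k).
pose z (k : {k | k \in B}) := x (sval k).
pose e (s : X i) (t : X j) : P :=
  dfwith (dfwith z i' s) j' t.
have eE1 s' t' : e s' t' i' = s' by rewrite /e dfwithout 1?eq_sym// dfwithin.
have eE2 s' t' : e s' t' j' = t' by rewrite /e dfwithin.
have rE s' t' : restriction Phi xbar (e s' t') =
    Phi (dfwith (dfwith x i s') j t').
  rewrite /restriction /e !glue_dfwith.
  suff -> : Defs.glue xbar z = x by [].
  apply: functional_extensionality_dep => k.
  have [kB|kB] := boolP (k \in B).
    exact: (glue_in xbar z (exist _ k kB)).
  exact: (glue_notin xbar z (exist _ k kB)).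
have wE (w : P) : e (w i') (w j') = w.
  apply: functional_extensionality_dep => k.
  have [->|->] : k = i' \/ k = j'; rewrite ?eE1 ?eE2//.
  by have := valP k; rewrite !inE => /orP[]/eqP kE; [left|right];
    exact: val_inj.
have [||U [oU [w Uw] UW rU]] := qPhi B B2 xbar (e s t) O
    ([set w : P | A (w i')] `&` [set w : P | C (w j')]).
- by rewrite rE.
- by apply: filterI; [apply: (pc i')|apply: (pc j')]; rewrite ?eE1 ?eE2.
have := @dfwith2_continuous _ (fun k : {i | i \in B} => X (sval k)) z i' j'
  (w i', w j') U.
rewrite /= -/(e _ _) wE => /(_ (open_nbhs_nbhs (conj oU Uw))).
move=> [[A' C'] /= [wA wC] AC].
have ACU s' t' : A'° s' -> C'° t' -> U (e s' t').
  by move=> /interior_subset As /interior_subset Ct; exact: (AC (s', t')).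
exists A'°, C'°; split.
- by split; exact: open_interior.
- by split; [exists (w i')|exists (w j')].
- move=> s' As; have := UW _ (ACU _ _ As wC); rewrite /= eE1.
  by case.
- move=> t' Ct; have := UW _ (ACU _ _ wA Ct); rewrite /= eE2.
  by case.
- move=> s' t' As Ct; rewrite -rE; apply: rU; exists (e s' t') => //.
  exact: ACU.
Qed.

Lemma quasicontinuous_real_extension (R : realType) (I : finType)
    (X : I -> topologicalType) (f : (forall i, X i) -> R) :
  (forall i, tychonoff_space (X i)) -> (forall i, feebly_compact (X i)) ->
  separately_continuous f -> (forall x, 0 <= f x <= 1) ->
  (forall x i j, i != j ->
    quasi_continuous2 (fun s t => f (dfwith (dfwith x i s) j t))) ->
  exists2 g : (forall i, stone_cech R (X i)) -> R, separately_continuous g &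
    forall x, g (fun i => to_stone_cech R (x i)) = f x.
Proof.
move=> hX fX cf f01 qf.
pose D i := range (to_stone_cech R (X:=X i)).
(* f is carried over to the image of the product, with the default 0 elsewhere; injectivity of X_i
   in beta X_i makes this well defined. *)
have [f0 f0E] : {f0 : (forall i, stone_cech R (X i)) -> R & forall z x,
    (fun i => to_stone_cech R (x i)) = z -> f0 z = f x}.
  apply: (@choice _ _ (fun z r => forall x,
    (fun i => to_stone_cech R (x i)) = z -> r = f x)) => z.
  have [[x xz]|nx] := pselect (exists x : forall i, X i,
    (fun i => to_stone_cech R (x i)) = z); last first.
    by exists 0 => x xz; case: nx; exists x.
  exists (f x) => x' x'z; congr f; apply: functional_extensionality_dep => i.
  apply: (to_stone_cech_inj (R:=R) (hX i)).
  exact: (congr1 (fun z => z i) (etrans xz (esym x'z))).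
have Dx z : (forall i, D i (z i)) -> exists x : forall i, X i,
    (fun i => to_stone_cech R (x i)) = z.
  move=> Dz; exists (fun i => projT1 (cid2 (Dz i))).
  by apply: functional_extensionality_dep => i; case: cid2.
have f0_dfwith x i t : f0 (dfwith (fun k => to_stone_cech R (x k)) i
    (to_stone_cech R t)) = f (dfwith x i t).
  apply: f0E.
  by rewrite -(map_dfwith (fun k => to_stone_cech R (X:=X k))).
have [|||||g cg gE] := @extend_all_coordinates R I _ D f0.
- move=> i; apply/seteqP; split => // p _ W /to_stone_cech_dense[x Wx].
  by exists (to_stone_cech R x); split => //; exists x.
- move=> i h p ch; have [x xh] := stone_cech_countable_approx p (fX i) ch.
  by exists (to_stone_cech R x) => //; exists x.
- by move=> z /Dx[x xz]; rewrite (f0E _ _ xz).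
- move=> _ /Dx[x <-] i.
  have [h [ch hE _]] := stone_cech_extension (cf x i) (fun t => f01 _).
  by exists h => // _ [t _ <-]; rewrite hE f0_dfwith.
- move=> _ /Dx[x <-] i j ij [s [t [v [a [b [DD ab small large]]]]]].
  have /choice[s' s'E] n : exists s', to_stone_cech R s' = s n.
    by have [[s' _ <-] _] := DD n; exists s'.
  have /choice[t' t'E] n : exists t', to_stone_cech R t' = t n.
    by have [_ [t' _ <-]] := DD n; exists t'.
  have E m n : f0 (dfwith (dfwith (fun k => to_stone_cech R (x k)) i (s m)) j (t n)) =
      f (dfwith (dfwith x i (s' m)) j (t' n)).
    rewrite -s'E -t'E (map_dfwith (fun k => to_stone_cech R (X:=X k))).
    exact: f0_dfwith.
  apply: (@quasi_continuous2_double_limit R _ _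
    (fun s t => f (dfwith (dfwith x i s) j t)) (fX i) (fX j)).
  + split=> [u|u]; first exact: cf.
    have -> : (fun s => f (dfwith (dfwith x i s) j u)) =
        (fun s => f (dfwith (dfwith x j u) i s)).
      by apply/funext => s1; rewrite dfwith_swap.
    exact: cf.
  + exact: qf.
  + by move=> *; exact: f01.
  + exists s', t', v, a, b; split => // m n mn; rewrite -E.
      exact: small.
    exact: large.
exists g => // x; rewrite gE; first exact: f0E.
by move=> i; exists (x i).
Qed.

Lemma quasicontinuous_dieudonne_extension (R : realType) (I : finType)
    (X : I -> topologicalType) (Y : topologicalType)
    (Phi : (forall i, X i) -> Y) :
  (forall i, tychonoff_space (X i)) -> (forall i, pseudocompact R (X i)) ->
  separately_continuous Phi -> quasicontinuous 2 Phi ->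
  extends_to_dieudonne_completion R Phi.
Proof.
move=> hX pX cPhi qPhi.
have fX i : feebly_compact (X i).
  by apply: (@pseudocompact_feebly_compact R) => //; case: (hX i).
pose D i := range (to_stone_cech R (X:=X i)).
pose iX (x : forall i, X i) i := to_stone_cech R (x i).
have Dx z : (forall i, D i (z i)) -> exists x : forall i, X i, iX x = z.
  move=> Dz; exists (fun i => projT1 (cid2 (Dz i))).
  by apply: functional_extensionality_dep => i; rewrite /iX; case: cid2.
have [g gP] : {g : unit_functions R Y -> (forall i, stone_cech R (X i)) -> R &
    forall phi, separately_continuous (g phi) /\
      forall x, g phi (iX x) = val phi (Phi x)}.
  apply: (@choice _ _ (fun phi g => separately_continuous g /\
    forall x, g (iX x) = val phi (Phi x))) => phi.
  have [cphi phi01] := set_mem (valP phi).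
  have [|x|x i j ij|g cg gE] := @quasicontinuous_real_extension R I X
    (fun x => val phi (Phi x)) hX fX.
  - by move=> x i t; apply: continuous_comp; [exact: cPhi|exact: cphi].
  - exact: phi01.
  - exact: quasi_continuous2_comp cphi (quasicontinuous_pair qPhi ij).
  by exists g.
(* The extensions of all phi o Phi are the coordinates of a single map into the product containing
   beta Y. *)
pose Psi z : unit_product R Y := fun phi => g phi z.
have cPsi z i : continuous (fun t => Psi (dfwith z i t)).
  by apply: prod_topology_continuous => phi; exact: (gP phi).1.
have PsiE x : Psi (iX x) = unit_eval R (Phi x).
  by apply/funext => phi; rewrite /Psi (gP phi).2.
have Psi_cl z : closure (range (unit_eval R (X:=Y))) (Psi z).
  apply: (coordinatewise_dense (D:=D)
    (P:=fun z => closure (range (unit_eval R (X:=Y))) (Psi z))) => {z} [z i zD p|z].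
    apply: (stone_cech_closed (C:=(fun t => Psi (dfwith z i t)) @^-1`
      closure (range (unit_eval R (X:=Y))))) => [|x].
      apply: closed_comp; last exact: closed_closure.
      by move=> t _; exact: cPsi.
    by apply: zD; exists x.
  move=> /Dx[x <-]; rewrite PsiE; apply: subset_closure.
  by exists (Phi x).
pose Psi1 z : stone_cech R Y := exist _ (Psi z) (mem_set (Psi_cl z)).
have cPsi1 z i : continuous (fun t => Psi1 (dfwith z i t)).
  by apply: continuous_set_type; exact: cPsi.
have Psi1E x : Psi1 (iX x) = to_stone_cech R (Phi x).
  by apply: val_inj; exact: PsiE.
have [Y_mu mu_complete _] := dieudonne_completion_smallest R Y.
(* Each section of [Psi1] is continuous on some beta X_i, so it stays in mu Y once it maps X_i
   there. *)
have Psi1_mu z : dieudonne_completion R Y (Psi1 z).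
  apply: (coordinatewise_dense (D:=D)
    (P:=fun z => dieudonne_completion R Y (Psi1 z))) => {z} [z i zD|z].
    apply: dieudonne_complete_stone_cech_range => //.
    - exact: hausdorff_stone_cech.
    - by move=> x; apply: zD; exists x.
  by move=> /Dx[x <-]; rewrite Psi1E; apply: Y_mu; exists (Phi x).
exists (fun z => exist _ (Psi1 z) (mem_set (Psi1_mu z))); split => [z i|x].
  by apply: continuous_set_type; exact: cPsi1.
exact: Psi1E.
Qed.

Theorem theorem5 (R : realType) (n : nat) (hn : (0 < n)%N)
    (X : 'I_n -> topologicalType) (Y : topologicalType)
    (hX : forall i, tychonoff_space (X i))
    (pX : forall i, pseudocompact R (X i))
    (hY : tychonoff_space Y)
    (Phi : (forall i, X i) -> Y) (sPhi : separately_continuous Phi) :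
  [<-> extends_to_dieudonne_completion R Phi;
       beta_extendable R 2 Phi;
       quasicontinuous 2 Phi].
Proof.
split; first exact: dieudonne_extension_beta_extendable.
split; first by apply: beta_extendable_quasicontinuous; case: hY.
exact: quasicontinuous_dieudonne_extension.
Qed.
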